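(* Let $1\le r<\infty$ and let $X$ be a $\mathcal D^r$ submanifold of $F^n$. Then $X$ has a finite cover by definable subsets which are open in $X$ and each of which is a quasi-special $\mathcal C^r$ submanifold.
   Context: Throughout, $\mathcal F=(F,<,+,\cdot,0,1,\ldots)$ is a definably complete locally o-minimal expansion of an ordered field: locally o-minimal means that for every definable $X\subseteq F$ and every $a\in F$ there is an open interval $I\ni a$ such that $X\cap I$ is a finite union of points and open intervals; definably complete means every definable subset of $F$ has a supremum and an infimum in $F\cup\{\pm\infty\}$. ''Definable'' means definable with parameters. $\mathcal D^r$ means definable and of class $\mathcal C^r$; a $\mathcal D^r$ diffeomorphism is a definable bijection that is $\mathcal D^r$ with $\mathcal D^r$ inverse. A $\mathcal D^r$ submanifold of dimension $d$ of $F^n$ is a definable $N\subseteq F^n$ such that for each $a\in N$ there exist a definable open neighborhood $U$ of $a$ in $F^n$, a definable open neighborhood $V$ of the origin, and a $\mathcal D^r$ diffeomorphism $\varphi:U\to V$ with $\varphi(a)=0$ and $\varphi(N\cap U)=\{x\in V\;|\;x_{d+1}=\cdots=x_n=0\}$. For a coordinate projection $\pi:F^n\to F^d$, a definable set $Y\subseteq F^n$ is a $\pi$-quasi-special $\mathcal C^r$ submanifold if $\pi(Y)$ is open and for every $x\in\pi(Y)$ there is an open box $U\ni x$ in $F^d$ such that for every $y\in Y\cap\pi^{-1}(x)$ there exist an open box $V\ni y$ in $F^n$ and a $\mathcal D^r$ map $\tau:U\to F^n$ with $\pi(V)=U$, $\tau(U)=Y\cap V$ and $\pi\circ\tau=\mathrm{id}_U$;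 it is a quasi-special $\mathcal C^r$ submanifold if this holds for some coordinate projection $\pi$. (An open box is a product of nonempty open intervals.) *)

(* Defs.v *)
(* Definable sets of an expansion of an ordered field are
   axiomatised as a van den Dries "structure" on R. *)
From mathcomp Require Import all_boot all_order all_algebra.
Set Implicit Arguments. Unset Strict Implicit. Unset Printing Implicit Defensive.
Import Order.TTheory GRing.Theory Num.Theory.
Local Open Scope ring_scope.

Section Defs.
Variable R : realFieldType.

Definition structure := forall n : nat, ('rV[R]_n -> Prop) -> Prop.

Definition ext_last n (y : 'rV[R]_n) (t : R) : 'rV[R]_n.+1 :=
  \row_(i < n.+1) match unlift ord_max i with Some j => y ord0 j | None => t end.

Definition i0_2 : 'I_2 := @Ordinal 2 0 isT.
Definition i1_2 : 'I_2 := @Ordinal 2 1 isT.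
Definition i0_3 : 'I_3 := @Ordinal 3 0 isT.
Definition i1_3 : 'I_3 := @Ordinal 3 1 isT.
Definition i2_3 : 'I_3 := @Ordinal 3 2 isT.

(* van den Dries' axioms for a structure, plus: it contains every point of F
   (parameters), the order and the graphs of + and * (expansion of an
   ordered field). *)
Definition is_structure (S : structure) : Prop :=
  (forall n, S n (fun _ => False)) /\
  (forall n A, S n A -> S n (fun x => ~ A x)) /\
  (forall n A B, S n A -> S n B -> S n (fun x => A x \/ B x)) /\
  (forall n A, S n A ->
     S n.+1 (fun x : 'rV_n.+1 => A (\row_(i < n) x ord0 (widen_ord (leqnSn n) i)))) /\
  (forall n A, S n A ->
     S n.+1 (fun x : 'rV_n.+1 => A (\row_(i < n) x ord0 (lift ord0 i)))) /\
  (forall n (i j : 'I_n), S n (fun x => x ord0 i = x ord0 j)) /\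
  (forall n A, S n.+1 A -> S n (fun y => exists t, A (ext_last y t))) /\
  (forall a : R, S 1 (fun x => x ord0 ord0 = a)) /\
  S 2 (fun x => x ord0 i0_2 < x ord0 i1_2) /\
  S 3 (fun x => x ord0 i2_3 = x ord0 i0_3 + x ord0 i1_3) /\
  S 3 (fun x => x ord0 i2_3 = x ord0 i0_3 * x ord0 i1_3).

Definition pt1 (t : R) : 'rV[R]_1 := \row_(i < 1) t.

Definition definably_complete (S : structure) : Prop :=
  forall A, S 1 A ->
    ((exists t, A (pt1 t)) -> (exists b, forall t, A (pt1 t) -> t <= b) ->
      exists s, (forall t, A (pt1 t) -> t <= s) /\
                (forall b, (forall t, A (pt1 t) -> t <= b) -> s <= b)) /\
    ((exists t, A (pt1 t)) -> (exists b, forall t, A (pt1 t) -> b <= t) ->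
      exists s, (forall t, A (pt1 t) -> s <= t) /\
                (forall b, (forall t, A (pt1 t) -> b <= t) -> b <= s)).

Definition locally_o_minimal (S : structure) : Prop :=
  forall A, S 1 A -> forall a : R,
    exists c d, c < a < d /\
      exists (ps : seq R) (ivs : seq (R * R)),
        forall t, c < t < d ->
          (A (pt1 t) <-> (t \in ps) \/ has (fun p => (p.1 < t) && (t < p.2)) ivs).

Definition box_ok n (lo hi : 'I_n -> R) := forall i, lo i < hi i.
Definition inbox n (lo hi : 'I_n -> R) (x : 'rV[R]_n) := forall i, lo i < x ord0 i < hi i.

Definition is_open n (U : 'rV[R]_n -> Prop) :=
  forall x, U x -> exists lo hi, box_ok lo hi /\ inbox lo hi x /\
    forall y, inbox lo hi y -> U y.

Definition open_in n (X Y : 'rV[R]_n -> Prop) :=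
  forall y, Y y -> exists lo hi, box_ok lo hi /\ inbox lo hi y /\
    forall z, X z -> inbox lo hi z -> Y z.

Definition cont_on n (J : Type) (U : 'rV[R]_n -> Prop) (f : 'rV[R]_n -> J -> R) :=
  forall x, U x -> forall e, 0 < e -> exists d, 0 < d /\
    forall y, U y -> (forall k, `|y ord0 k - x ord0 k| < d) ->
      forall j, `|f y j - f x j| < e.

Definition frechet n (J : Type) (f : 'rV[R]_n -> J -> R) (x : 'rV[R]_n)
    (L : J * 'I_n -> R) :=
  forall e, 0 < e -> exists d, 0 < d /\
    forall h : 'rV[R]_n, (forall k, `|h ord0 k| < d) ->
      forall j, `|f (x + h) j - f x j - \sum_(k < n) L (j, k) * h ord0 k|
                 <= e * \sum_(k < n) `|h ord0 k|.

Fixpoint Cr (r : nat) (n : nat) (J : Type) (U : 'rV[R]_n -> Prop)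
    (f : 'rV[R]_n -> J -> R) {struct r} : Prop :=
  cont_on U f /\
  match r with
  | 0 => True
  | r'.+1 => exists Df : 'rV[R]_n -> J * 'I_n -> R,
      (forall x, U x -> frechet f x (Df x)) /\ Cr r' U Df
  end.

Definition def_map (S : structure) n m (U : 'rV[R]_n -> Prop)
    (f : 'rV[R]_n -> 'rV[R]_m) :=
  S (n + m)%N (fun z : 'rV[R]_(n + m) => U (lsubmx z) /\ f (lsubmx z) = rsubmx z).

Definition Dr_map (S : structure) (r : nat) n m (U : 'rV[R]_n -> Prop)
    (f : 'rV[R]_n -> 'rV[R]_m) :=
  def_map S U f /\ Cr r U (fun x j => f x ord0 j).

Definition Dr_diffeo (S : structure) (r : nat) n (U V : 'rV[R]_n -> Prop)
    (phi : 'rV[R]_n -> 'rV[R]_n) :=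
  exists psi : 'rV[R]_n -> 'rV[R]_n,
    Dr_map S r U phi /\ Dr_map S r V psi /\
    (forall x, U x -> V (phi x) /\ psi (phi x) = x) /\
    (forall y, V y -> U (psi y) /\ phi (psi y) = y).

Definition Dr_submanifold_dim (S : structure) (r n d : nat) (X : 'rV[R]_n -> Prop) :=
  S n X /\ (d <= n)%N /\
  forall a, X a -> exists (U V : 'rV[R]_n -> Prop) (phi : 'rV[R]_n -> 'rV[R]_n),
    S n U /\ is_open U /\ U a /\ S n V /\ is_open V /\ V 0 /\
    Dr_diffeo S r U V phi /\ phi a = 0 /\
    forall y, (exists x, X x /\ U x /\ phi x = y) <->
              (V y /\ forall k : 'I_n, (d <= k)%N -> y ord0 k = 0).

Definition Dr_submanifold (S : structure) (r n : nat) (X : 'rV[R]_n -> Prop) :=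
  exists d, Dr_submanifold_dim S r d X.

Definition coord_proj n d (sigma : 'I_d -> 'I_n) (x : 'rV[R]_n) : 'rV[R]_d :=
  \row_(i < d) x ord0 (sigma i).

Definition pi_quasi_special (S : structure) (r n d : nat) (sigma : 'I_d -> 'I_n)
    (Y : 'rV[R]_n -> Prop) :=
  let pi := coord_proj sigma in
  is_open (fun u => exists y, Y y /\ pi y = u) /\
  forall x, (exists y, Y y /\ pi y = x) ->
    exists loU hiU, box_ok loU hiU /\ inbox loU hiU x /\
      forall y, Y y -> pi y = x ->
        exists loV hiV, box_ok loV hiV /\ inbox loV hiV y /\
          exists tau : 'rV[R]_d -> 'rV[R]_n,
            Dr_map S r (inbox loU hiU) tau /\
            (forall u, inbox loU hiU u <-> exists v, inbox loV hiV v /\ pi v = u) /\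
            (forall z, (exists u, inbox loU hiU u /\ tau u = z) <->
                       (Y z /\ inbox loV hiV z)) /\
            (forall u, inbox loU hiU u -> pi (tau u) = u).

Definition quasi_special (S : structure) (r n : nat) (Y : 'rV[R]_n -> Prop) :=
  exists (d : nat) (sigma : 'I_d -> 'I_n),
    (forall i j : 'I_d, (i < j)%N -> (sigma i < sigma j)%N) /\
    pi_quasi_special S r sigma Y.

End Defs.

(* Main.v *)
Require Import Defs.
From mathcomp Require Import all_boot all_order all_algebra.
From mathcomp Require Import ring lra.
From Stdlib Require Import Classical ClassicalEpsilon FunctionalExtensionality PropExtensionality.
Import Order.TTheory GRing.Theory Num.Theory.
Local Open Scope ring_scope.
Set Implicit Arguments. Unset Strict Implicit. Unset Printing Implicit Defensive.

(* For an increasing [sigma : 'I_d -> 'I_n], let [Y_sigma] be the set of points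
   of [X] near which the projection onto the coordinates [sigma] is
   bi-Lipschitz on [X].  This condition is first-order, hence [Y_sigma] is
   definable, and open in [X].  If [p] is a local parametrization of [X], it
   says that the minor [sigma] of the differential of [p] is invertible; so the
   finitely many [Y_sigma] cover [X] because this differential has rank [d], and
   the inverse function theorem makes [Y_sigma] locally the graph of a [C^r] map.

   The definition of a quasi-special submanifold asks for a box that works for
   all points of a fiber simultaneously, and a fiber is discrete but possibly
   infinite.  If no such box existed, the supremum of the admissible radii
   would be a definable function on the fiber taking arbitrarily small values,
   so by local o-minimality its range would contain an interval.  This is
   impossible, as a definable function on a bounded, uniformly separated
   definable set has a range with empty interior: by definable completeness one
   can argue by induction along each coordinate, using that the union
   of two definable sets with empty interior has empty interior. *)

(** Charts are given point by point, with no uniformity in the point, so no formula can speak of the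
    rank of their differentials; a condition on pairs of points of [X] avoids this. The field may be
    non-archimedean and need be neither Cauchy complete nor locally compact. The mean value
    inequality and the inverse function theorem are therefore proved without limits or compactness,
    from suprema of definable sets, and every function they are applied to has to be definable.
    Local inverses and sections, in contrast, are picked by choice with no claim of definability.
    Only the final section [tau] needs it, and obtains it from its graph: on a small ball the
    projection is injective on [Y_sigma], so the graph is described by a formula that does not
    mention [tau]. *)

Section Coordinates.
Variable R : realFieldType.

(** Padding with 0 maps every ['rV_n] into [nat -> R], so that formulas with different numbers of
    free variables have one type. *)
Definition coords n (x : 'rV[R]_n) (k : nat) : R :=
  if insub k is Some i then x ord0 i else 0.

Lemma coords_ord n (x : 'rV[R]_n) (i : 'I_n) : coords x i = x ord0 i.
Proof. by rewrite /coords valK. Qed.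

Lemma coords_lt n (x : 'rV[R]_n) k (h : (k < n)%N) : coords x k = x ord0 (Ordinal h).
Proof. by rewrite -(coords_ord x (Ordinal h)). Qed.

Lemma coords_ge n (x : 'rV[R]_n) k : (n <= k)%N -> coords x k = 0.
Proof. by move=> h; rewrite /coords insubF // ltnNge h. Qed.

Lemma row_coords n (x : 'rV[R]_n) : \row_i coords x i = x.
Proof. by apply/rowP => i; rewrite mxE coords_ord. Qed.

Lemma coords_row n (e : nat -> R) k :
  coords (\row_(i < n) e i) k = if (k < n)%N then e k else 0.
Proof.
by case: ltnP => h; [rewrite (coords_lt _ h) mxE | rewrite coords_ge].
Qed.

Lemma coords_ext_last n (y : 'rV[R]_n) t k :
  coords (ext_last y t) k = if k == n then t else coords y k.
Proof.
case: (ltngtP k n) => h; last 1 first.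
- subst k; rewrite (coords_lt _ (ltnSn n)) mxE.
  have -> : Ordinal (ltnSn n) = ord_max by apply: val_inj.
  by rewrite unlift_none.
- have h' : (k < n.+1)%N by rewrite ltnS ltnW.
  rewrite (coords_lt _ h') mxE (coords_lt _ h).
  have -> : Ordinal h' = lift ord_max (Ordinal h).
    by apply: val_inj; rewrite /= /bump leqNgt h.
  by rewrite liftK.
by rewrite !coords_ge // ltnW.
Qed.

Lemma coords_tail n (x : 'rV[R]_n.+1) k :
  coords (\row_(i < n) x ord0 (lift ord0 i)) k = coords x k.+1.
Proof.
case: (ltnP k n) => h; last by rewrite !coords_ge.
rewrite (coords_lt _ h) mxE -coords_ord /=.
by congr coords.
Qed.

Lemma coords_init n (x : 'rV[R]_n.+1) k :
  coords (\row_(i < n) x ord0 (widen_ord (leqnSn n) i)) k =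
  if (k < n)%N then coords x k else 0.
Proof.
case: (ltnP k n) => h; last by rewrite coords_ge.
by rewrite (coords_lt _ h) mxE -coords_ord.
Qed.

End Coordinates.

Definition scons R (t : R) (e : nat -> R) (k : nat) : R :=
  if k is k'.+1 then e k' else t.

(** * Closure of definable sets under first-order formulas *)

Section Definability.
Variables (R : realFieldType) (S : structure R).
Hypothesis hS : is_structure S.
Implicit Types (P Q : (nat -> R) -> Prop) (e : nat -> R).

Lemma structure_ext n (A B : 'rV[R]_n -> Prop) : (forall x, A x <-> B x) -> S A -> S B.
Proof.
move=> h; suff -> : A = B by [].
by apply: functional_extensionality => x; apply: propositional_extensionality.
Qed.

Lemma structure_not n (A : 'rV[R]_n -> Prop) : S A -> S (fun x => ~ A x).
Proof. by case: hS => _ [h _]; exact: h. Qed.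

Lemma structure_or n (A B : 'rV[R]_n -> Prop) : S A -> S B -> S (fun x => A x \/ B x).
Proof. by case: hS => _ [_ [h _]]; exact: h. Qed.

Lemma structure_and n (A B : 'rV[R]_n -> Prop) : S A -> S B -> S (fun x => A x /\ B x).
Proof.
move=> hA hB.
apply: structure_ext (structure_not (structure_or (structure_not hA) (structure_not hB))) => x.
by split; [move=> /not_or_and [/NNPP ? /NNPP ?] | move=> [a b] []].
Qed.

Lemma structure_true n : S (fun _ : 'rV[R]_n => True).
Proof.
have h0 : S (fun _ : 'rV[R]_n => False) by case: hS => h _; exact: h.
by apply: structure_ext (structure_not h0) => x; split=> // _ [].
Qed.

Lemma structure_forall_lt n m (A : nat -> 'rV[R]_n -> Prop) :
  (forall i, (i < m)%N -> S (A i)) -> S (fun x => forall i, (i < m)%N -> A i x).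
Proof.
elim: m => [|m IH] h; first by apply: structure_ext (structure_true n) => x; split.
have h1 : S (fun x => forall i, (i < m)%N -> A i x).
  by apply: IH => i hi; apply: h; rewrite ltnS ltnW.
apply: structure_ext (structure_and h1 (h m (ltnSn m))) => x; split.
- by move=> [ha hb] i; rewrite ltnS leq_eqVlt => /orP [/eqP -> // | /ha].
- by move=> ha; split=> [i hi|]; apply: ha => //; rewrite ltnS ltnW.
Qed.

Definition env_set n P := S (fun x : 'rV[R]_n => P (coords x)).

(** [env_set n P] tests [P] only on assignments that vanish from index [n] on; with this condition
    the test determines [P] everywhere. *)
Definition supported n P :=
  forall e e', (forall k, (k < n)%N -> e k = e' k) -> P e -> P e'.

Lemma supportedP n P e e' : supported n P -> (forall k, (k < n)%N -> e k = e' k) -> P e <-> P e'.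
Proof. by move=> h he; split; apply: h => // k /he. Qed.

Lemma env_set_row n (A : 'rV[R]_n -> Prop) :
  S A <-> env_set n (fun e => A (\row_i e i)).
Proof. by split; apply: structure_ext => x; rewrite row_coords. Qed.

Lemma env_set_shift n m P : env_set n P -> env_set (m + n) (fun e => P (fun i => e (m + i)%N)).
Proof.
move=> h; elim: m => [|m IH]; first exact: h.
case: hS => _ [_ [_ [_ [hl _]]]].
apply: structure_ext (hl _ _ IH) => x.
suff -> : (fun i => coords (\row_(i0 < m + n) x ord0 (lift ord0 i0)) (m + i)) =
          (fun i => coords x (m.+1 + i)) by [].
by apply: functional_extensionality => i; rewrite coords_tail.
Qed.

Lemma env_set_weaken n m P : supported n P -> (n <= m)%N -> env_set n P -> env_set m P.
Proof.
move=> hs hnm h; rewrite -(subnKC hnm); elim: (m - n)%N => [|k IH]; first by rewrite addn0.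
rewrite addnS; case: hS => _ [_ [_ [hi _]]].
apply: structure_ext (hi _ _ IH) => x; apply: (supportedP hs) => j hj.
by rewrite coords_init (leq_trans hj) // leq_addr.
Qed.

Lemma env_set_exists n P : env_set n.+1 P ->
  env_set n (fun e => exists t, P (fun i => if i == n then t else e i)).
Proof.
case: hS => _ [_ [_ [_ [_ [_ [hp _]]]]]] /hp; apply: structure_ext => x.
by split=> -[t ht]; exists t; move: ht; congr P;
  apply: functional_extensionality => i; rewrite coords_ext_last.
Qed.

Lemma env_set_exists_tail n m P : supported (n + m) P -> env_set (n + m) P ->
  env_set n (fun e => exists e', (forall k, (k < n)%N -> e' k = e k) /\ P e').
Proof.
elim: m P => [|m IH] P.
  rewrite addn0 => hs; apply: structure_ext => x; split=> [h|[e' [he]]].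
    by exists (coords x).
  by apply: hs.
rewrite addnS => hs /env_set_exists h.
have hs' : supported (n + m) (fun e => exists t, P (fun i => if i == n + m then t else e i)).
  move=> e e' he [t ht]; exists t; apply: hs ht => k.
  by rewrite ltnS leq_eqVlt; case: eqP => //= _ /he.
apply: structure_ext (IH _ hs' h) => x; split.
- move=> [e' [he [t ht]]]; eexists; split; last exact: ht.
  move=> k hk /=; rewrite ltn_eqF ?he //.
  by apply: leq_trans hk _; rewrite leq_addr.
- move=> [e' [he he']]; exists e'; split=> //; exists (e' (n + m)%N).
  by apply: hs he' => k _; case: eqP => [->|].
Qed.

Lemma env_set_eq n i j : (i < n)%N -> (j < n)%N -> env_set n (fun e => e i = e j).
Proof.
move=> hi hj; case: hS => _ [_ [_ [_ [_ [he _]]]]].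
by apply: structure_ext (he n (Ordinal hi) (Ordinal hj)) => x; rewrite (coords_lt _ hi) (coords_lt _ hj).
Qed.

(** The axioms offer no substitution. Fresh variables [n + i] carry the values of the terms, [C i]
    states their defining equations, and the fresh block is projected away. *)
Lemma env_set_subst n m P (C : nat -> (nat -> R) -> Prop) (T : nat -> (nat -> R) -> R) :
  supported m P -> env_set m P ->
  (forall i, (i < m)%N -> env_set (n + m) (C i)) ->
  (forall i e, (i < m)%N -> C i e <-> e (n + i)%N = T i e) ->
  (forall i e e', (i < m)%N -> (forall k, (k < n)%N -> e k = e' k) -> T i e = T i e') ->
  env_set n (fun e => P (fun i => T i e)).
Proof.
move=> hs hP hC hCT hT.
pose Q e := P (fun i => e (n + i)%N) /\ forall i, (i < m)%N -> C i e.
have hQ : env_set (n + m) Q.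
  exact: (structure_and (env_set_shift n hP) (structure_forall_lt hC)).
have hsQ : supported (n + m) Q.
  move=> e e' he [h1 h2]; split.
    by apply: hs h1 => k hk; apply: he; rewrite ltn_add2l.
  move=> i hi; apply/hCT => //; rewrite -he ?ltn_add2l //.
  rewrite (iffLR (hCT _ _ hi) (h2 i hi)); apply: hT => // k hk; apply: he.
  by apply: leq_trans hk _; rewrite leq_addr.
apply: structure_ext (env_set_exists_tail hsQ hQ) => x; split.
- move=> [e [he [h1 h2]]]; apply: hs h1 => k hk.
  by rewrite (iffLR (hCT _ _ hk) (h2 k hk)); apply: hT.
- move=> h; pose e k := if (k < n)%N then coords x k else T (k - n)%N (coords x).
  have he k : (k < n)%N -> e k = coords x k by rewrite /e => ->.
  have heT k : e (n + k)%N = T k (coords x) by rewrite /e ltnNge leq_addr addKn.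
  exists e; split=> //; split; first by apply: hs h => k hk.
  by move=> i hi; apply/hCT => //; rewrite heT; apply: hT => // k /he.
Qed.

Lemma env_set_rename n m P (f : nat -> nat) : supported m P -> env_set m P ->
  (forall i, (i < m)%N -> (f i < n)%N) -> env_set n (fun e => P (fun i => e (f i))).
Proof.
move=> hs hP hf.
apply: (@env_set_subst n m P (fun i e => e (n + i)%N = e (f i)) (fun i e => e (f i))) => //.
- move=> i hi; apply: env_set_eq; rewrite ?ltn_add2l //.
  by apply: leq_trans (hf i hi) _; rewrite leq_addr.
- by move=> i e e' hi; apply; apply: hf.
Qed.

(* A predicate on infinite assignments is definable when it only looks at
   finitely many variables, and is definable in these. *)
Definition dpred P := exists n, supported n P /\ env_set n P.
Definition dterm (t : (nat -> R) -> R) := dpred (fun e => e 0%N = t (fun i => e i.+1)).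

Lemma dpred_iff P Q : (forall e, P e <-> Q e) -> dpred P -> dpred Q.
Proof.
move=> h; suff -> : P = Q by [].
by apply: functional_extensionality => x; apply: propositional_extensionality.
Qed.

(** [dterm] is made opaque below, which keeps the definability tactic from treating terms as
    formulas; the graph stays accessible through this lemma. *)
Lemma dterm_graph t : dpred (fun e => e 0%N = t (fun i => e i.+1)) -> dterm t.
Proof. by []. Qed.

Lemma dterm_ext s t : s =1 t -> dterm s -> dterm t.
Proof. by move=> h; apply: dpred_iff => e; rewrite h. Qed.

Lemma dpred_not P : dpred P -> dpred (fun e => ~ P e).
Proof.
move=> [n [hs h]]; exists n; split; last exact: structure_not h.
by move=> e e' he hn h'; apply: hn; apply: hs h' => k /he.
Qed.

Lemma dpred_and P Q : dpred P -> dpred Q -> dpred (fun e => P e /\ Q e).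
Proof.
move=> [n [hs h]] [m [hs' h']]; exists (maxn n m); split.
  move=> e e' he [h1 h2]; split; [apply: hs h1 | apply: hs' h2] => k hk;
    by apply: he; rewrite leq_max hk ?orbT.
by apply: structure_and; [apply: env_set_weaken h | apply: env_set_weaken h'];
  rewrite // leq_max leqnn ?orbT.
Qed.

Lemma dpred_or P Q : dpred P -> dpred Q -> dpred (fun e => P e \/ Q e).
Proof.
move=> hP hQ; apply: dpred_iff (dpred_not (dpred_and (dpred_not hP) (dpred_not hQ))) => e.
by split; [move=> /not_and_or [/NNPP|/NNPP]; [left|right] | move=> h []; case: h].
Qed.

Lemma dpred_imp P Q : dpred P -> dpred Q -> dpred (fun e => P e -> Q e).
Proof.
move=> hP hQ; apply: dpred_iff (dpred_or (dpred_not hP) hQ) => e.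
split; first by case.
by move=> h; case: (classic (P e)) => [/h|]; [right|left].
Qed.

Lemma dpred_iff2 P Q : dpred P -> dpred Q -> dpred (fun e => P e <-> Q e).
Proof. by move=> hP hQ; apply: dpred_and; apply: dpred_imp. Qed.

Lemma dpred_const (A : Prop) : dpred (fun _ => A).
Proof.
exists 0%N; split=> //; case: (classic A) => h.
  by apply: structure_ext (structure_true 0) => x.
by case: hS => h0 _; apply: structure_ext (h0 0%N) => x.
Qed.

Lemma dpred_rename P (f : nat -> nat) : dpred P -> dpred (fun e => P (fun i => e (f i))).
Proof.
move=> [m [hs h]]; exists (\max_(i < m) (f i)).+1.
have hf i : (i < m)%N -> (f i < (\max_(i < m) (f i)).+1)%N.
  by move=> hi; rewrite ltnS; apply: (@leq_bigmax _ (fun i : 'I_m => f i) (Ordinal hi)).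
split; last exact: env_set_rename hs h hf.
by move=> e e' he; apply: hs => k /hf /he.
Qed.

Lemma dpred_exists_scons P : dpred P -> dpred (fun e => exists t, P (scons t e)).
Proof.
move=> [n [hs h]]; exists n; split.
  move=> e e' he [t ht]; exists t; apply: hs ht => -[|k] //= hk.
  by apply: he; apply: ltnW.
(* The bound variable stands first here but last in [env_set_exists], hence the rotation [f]. *)
pose f k := if k is k'.+1 then k' else n.
have hf i : (i < n)%N -> (f i < n.+1)%N by case: i => [|i] //= hi; rewrite ltnS ltnW // ltnW.
apply: structure_ext (env_set_exists (env_set_rename hs h hf)) => x.
split=> -[t ht]; exists t; apply: hs ht => -[|k] hk /=; rewrite ?eqxx //.
  by rewrite ltn_eqF // ltnW.
by rewrite ltn_eqF // ltnW.
Qed.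

Lemma dpred_exists (P : (nat -> R) -> R -> Prop) :
  dpred (fun e => P (fun i => e i.+1) (e 0%N)) -> dpred (fun e => exists t, P e t).
Proof. by move/dpred_exists_scons. Qed.

Lemma dpred_forall (P : (nat -> R) -> R -> Prop) :
  dpred (fun e => P (fun i => e i.+1) (e 0%N)) -> dpred (fun e => forall t, P e t).
Proof.
move=> h; apply: dpred_iff (dpred_not (dpred_exists (P := fun e t => ~ P e t) (dpred_not h))) => e.
by split; [move=> hn t; apply: NNPP => ht; apply: hn; exists t | move=> ha [t]; apply].
Qed.

Lemma dpred_exists_row m (P : (nat -> R) -> 'rV[R]_m -> Prop) :
  dpred (fun e => P (fun i => e (m + i)%N) (\row_i e i)) -> dpred (fun e => exists v, P e v).
Proof.
(* For an arbitrary [Q] on assignments the claim can be proved by induction on [m], quantifying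
   variable 0 first. *)
suff h Q : dpred Q -> dpred (fun e => exists v : 'rV[R]_m,
    Q (fun i => if (i < m)%N then coords v i else e (i - m)%N)).
  move/h; apply: dpred_iff => e; split=> -[v hv]; exists v; move: hv;
    (have -> : (fun i => if (m + i < m)%N then coords v (m + i) else e (m + i - m)%N) = e by
      apply: functional_extensionality => i; rewrite ltnNge leq_addr addKn);
    by (have -> : \row_i (if (i < m)%N then coords v i else e (i - m)%N) = v by
      apply/rowP => i; rewrite mxE ltn_ord coords_ord).
elim: {P} m Q => [|m IH] Q hQ.
  apply: dpred_iff hQ => e; split=> [h|[v]].
    by exists 0; move: h; congr Q; apply: functional_extensionality => i; rewrite subn0.
  by congr Q; apply: functional_extensionality => i; rewrite subn0.
apply: dpred_iff (IH _ (dpred_exists_scons hQ)) => e; split.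
- move=> [v [t hv]]; exists (\row_(i < m.+1) scons t (coords v) i).
  move: hv; congr Q; apply: functional_extensionality => i.
  by case: i => [|i] /=; rewrite coords_row //= ltnS subSS; case: ltnP.
- move=> [v hv]; exists (\row_(i < m) coords v i.+1), (coords v 0).
  move: hv; congr Q; apply: functional_extensionality => i.
  case: i => [|i] //=.
  by rewrite (coords_row m (fun i => coords v i.+1)) ltnS subSS; case: ltnP.
Qed.

Lemma dpred_forall_row m (P : (nat -> R) -> 'rV[R]_m -> Prop) :
  dpred (fun e => P (fun i => e (m + i)%N) (\row_i e i)) -> dpred (fun e => forall v, P e v).
Proof.
move=> h; apply: dpred_iff (dpred_not (dpred_exists_row (P := fun e t => ~ P e t) (dpred_not h))) => e.
by split; [move=> hn t; apply: NNPP => ht; apply: hn; exists t | move=> ha [t]; apply].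
Qed.

Lemma dpred_forall_ord m (P : 'I_m -> (nat -> R) -> Prop) :
  (forall i, dpred (P i)) -> dpred (fun e => forall i, P i e).
Proof.
elim: m P => [|m IH] P h; first by apply: dpred_iff (dpred_const True) => e; split=> // _ [].
have h1 := IH _ (fun i => h (lift ord0 i)).
apply: dpred_iff (dpred_and (h ord0) h1) => e; split=> [[h2 h3] i|h2].
  by case: (unliftP ord0 i) => [j|] ->.
by split=> [|i]; apply: h2.
Qed.

Lemma dpred_subst P (T : nat -> (nat -> R) -> R) : dpred P -> (forall i, dterm (T i)) ->
  dpred (fun e => P (fun i => T i e)).
Proof.
move=> [m [hs h]] hT.
(* Only the first [m] terms matter, so one [b] bounds all the variables they look at. *)
have [b hb] : exists b, forall i, (i < m)%N -> supported b.+1 (fun e => e 0%N = T i (fun i => e i.+1))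
   /\ env_set b.+1 (fun e => e 0%N = T i (fun i => e i.+1)).
  elim: m {hs h} => [|m [b hb]]; first by exists 0%N.
  case: (hT m) => c [hc1 hc2]; exists (maxn b c) => i.
  have hmono k l Q : (k <= l)%N -> supported k Q /\ env_set k Q -> supported l Q /\ env_set l Q.
    move=> hkl [h1 h2]; split; last exact: env_set_weaken h2.
    by move=> e e' he; apply: h1 => j hj; apply: he; apply: leq_trans hkl.
  rewrite ltnS leq_eqVlt => /orP [/eqP -> | /hb].
    by apply: hmono (conj hc1 hc2); rewrite leqW // leq_maxr.
  by apply: hmono; rewrite ltnS leq_maxl.
have hT' i e e' : (i < m)%N -> (forall k, (k < b)%N -> e k = e' k) -> T i e = T i e'.
  move=> /hb [h1 _] he.
  have := h1 (scons (T i e) e) (scons (T i e) e'); apply=> //.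
  by case=> [|k] //= /he.
exists b; split.
  by move=> e e' he; apply: hs => k hk; apply: hT'.
apply: (@env_set_subst b m P (fun i e => e (b + i)%N = T i e)) => //.
move=> i hi; case: (hb i hi) => h1 h2.
pose f k := if k is k'.+1 then k' else (b + i)%N.
have := @env_set_rename (b + m) b.+1 _ f h1 h2.
apply=> -[|k] /= hk; first by rewrite ltn_add2l.
by apply: leq_trans (leq_addr _ _).
Qed.

Lemma dterm_var k : dterm (fun e => e k).
Proof.
have h : dpred (fun e => e 0%N = e 1%N).
  exists 2%N; split; last exact: env_set_eq.
  by move=> e e' he; rewrite !he.
exact: (dpred_rename (fun i => if i == 0%N then 0%N else k.+1) h).
Qed.

Lemma dpred_structure n (A : 'rV[R]_n -> Prop) (v : (nat -> R) -> 'rV[R]_n) :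
  S A -> (forall i, dterm (fun e => v e ord0 i)) -> dpred (fun e => A (v e)).
Proof.
move=> hA hv.
have h : dpred (fun e => A (\row_(i < n) e i)).
  exists n; split; last exact: (iffLR (env_set_row A) hA).
  move=> e e' he; suff -> : \row_(i < n) e i = \row_(i < n) e' i by [].
  by apply/rowP => i; rewrite !mxE he.
pose T k e := if insub k is Some i then v e ord0 i else e 0%N.
have hT k : dterm (T k) by rewrite /T; case: insubP => [i _ _|_]; [apply: hv | apply: dterm_var].
apply: dpred_iff (dpred_subst h hT) => e.
by suff -> : \row_(i < n) T i e = v e by []; apply/rowP => i; rewrite mxE /T valK.
Qed.

Lemma structure_dpred n (A : 'rV[R]_n -> Prop) : dpred (fun e => A (\row_i e i)) -> S A.
Proof.
move=> [m [hs h]].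
pose f k := if (k < n)%N then k else n.
(* The witness [m] may exceed [n] although the formula reads only the first [n] variables; the
   surplus variables are projected away. *)
suff hn : S (fun x : 'rV[R]_n => exists e', (forall k, (k < n)%N -> e' k = coords x k) /\ A (\row_i e' i)).
  apply: structure_ext hn => x; split=> [[e' [he]]|hx].
    by suff -> : \row_(i < n) e' i = x by []; apply/rowP => i; rewrite mxE he // coords_ord.
  by exists (coords x); rewrite row_coords.
apply: (@env_set_exists_tail n m).
- move=> e e' he; suff -> : \row_(i < n) e i = \row_(i < n) e' i by [].
  by apply/rowP => i; rewrite !mxE he // (leq_trans (ltn_ord i)) // leq_addr.
- by apply: env_set_weaken h => //; rewrite leq_addl.
Qed.

Lemma dterm_const c : dterm (fun _ => c).
Proof.
have [_ [_ [_ [_ [_ [_ [_ [h _]]]]]]]] := hS.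
apply: dpred_iff (@dpred_structure 1 _ (fun e => \row_(i < 1) e i) (h c) _) => [e|i].
  by rewrite mxE.
by apply: dterm_ext (dterm_var i) => e; rewrite mxE.
Qed.

Lemma dpred_lt s t : dterm s -> dterm t -> dpred (fun e => s e < t e).
Proof.
have [_ [_ [_ [_ [_ [_ [_ [_ [h _]]]]]]]]] := hS => hs ht.
have h' : dpred (fun e => e 0%N < e 1%N).
  have := @dpred_structure 2 _ (fun e => \row_(i < 2) e i) h _.
  rewrite /= => H; apply: dpred_iff (H _) => [e|i]; first by rewrite !mxE.
  by apply: dterm_ext (dterm_var i) => e; rewrite mxE.
by have := dpred_subst (T := fun i => if i == 0%N then s else t) h';
  apply=> i; case: ifP.
Qed.

Lemma dpred_eq s t : dterm s -> dterm t -> dpred (fun e => s e = t e).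
Proof.
move=> hs ht; apply: dpred_iff (dpred_and (dpred_not (dpred_lt hs ht)) (dpred_not (dpred_lt ht hs))) => e.
split; last by move=> ->; rewrite ltxx.
by move=> [/negP h1 /negP h2]; apply/eqP; rewrite eq_le !leNgt h1 h2.
Qed.

Lemma dpred_le s t : dterm s -> dterm t -> dpred (fun e => s e <= t e).
Proof.
move=> hs ht; apply: dpred_iff (dpred_not (dpred_lt ht hs)) => e.
by rewrite leNgt; split=> /negP.
Qed.

Lemma dterm_subst t (T : nat -> (nat -> R) -> R) : dterm t -> (forall i, dterm (T i)) ->
  dterm (fun e => t (fun i => T i e)).
Proof.
move=> ht hT.
pose T' k e := if k is k'.+1 then T k' (fun i => e i.+1) else e 0%N.
apply: (@dpred_subst _ T' ht) => -[|k] /=; first exact: dterm_var.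
exact: (dpred_rename (fun k => if k is k'.+1 then k'.+2 else 0%N) (hT k)).
Qed.

Lemma dterm_add s t : dterm s -> dterm t -> dterm (fun e => s e + t e).
Proof.
have [_ [_ [_ [_ [_ [_ [_ [_ [_ [h _]]]]]]]]]] := hS => hs ht.
have h' : dterm (fun e => e 0%N + e 1%N).
  pose v e : 'rV[R]_3 := \row_(i < 3) e (nth 0%N [:: 1; 2; 0] i).
  apply: dpred_iff (@dpred_structure 3 _ v h _) => [e|i]; first by rewrite !mxE.
  by apply: dterm_ext (dterm_var (nth 0%N [:: 1; 2; 0] i)) => e; rewrite mxE.
by have := dterm_subst (T := fun i => if i == 0%N then s else t) h'; apply=> i; case: ifP.
Qed.

Lemma dterm_mul s t : dterm s -> dterm t -> dterm (fun e => s e * t e).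
Proof.
have [_ [_ [_ [_ [_ [_ [_ [_ [_ [_ h]]]]]]]]]] := hS => hs ht.
have h' : dterm (fun e => e 0%N * e 1%N).
  pose v e : 'rV[R]_3 := \row_(i < 3) e (nth 0%N [:: 1; 2; 0] i).
  apply: dpred_iff (@dpred_structure 3 _ v h _) => [e|i]; first by rewrite !mxE.
  by apply: dterm_ext (dterm_var (nth 0%N [:: 1; 2; 0] i)) => e; rewrite mxE.
by have := dterm_subst (T := fun i => if i == 0%N then s else t) h'; apply=> i; case: ifP.
Qed.

Lemma dterm_opp t : dterm t -> dterm (fun e => - t e).
Proof.
move=> ht; apply: dterm_ext (dterm_mul (dterm_const (-1)) ht) => e.
by rewrite mulN1r.
Qed.

Lemma dterm_sum (I : Type) (s : seq I) (t : I -> (nat -> R) -> R) :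
  (forall i, dterm (t i)) -> dterm (fun e => \sum_(i <- s) t i e).
Proof.
move=> h; elim: s => [|i s IH].
  by apply: dterm_ext (dterm_const 0) => e; rewrite big_nil.
by apply: dterm_ext (dterm_add (h i) IH) => e; rewrite big_cons.
Qed.

Lemma dterm_norm t : dterm t -> dterm (fun e => `|t e|).
Proof.
move=> ht.
have h : dterm (fun e => `|e 0%N|).
  apply: (@dpred_iff (fun e => 0 <= e 0%N /\ (e 0%N = e 1%N \/ e 0%N = - e 1%N))) => [e|].
    split=> [[h0 [] h1]|->]; [by rewrite -h1 ger0_norm | by rewrite -normrN -h1 ger0_norm |].
    split; first exact: normr_ge0.
    case: (leP 0 (e 1%N)) => h; [left; exact: ger0_norm | right; exact: ltr0_norm].
  apply: dpred_and; first by apply: dpred_le; [apply: dterm_const | apply: dterm_var].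
  apply: dpred_or; apply: dpred_eq; try apply: dterm_opp; exact: dterm_var.
exact: (dterm_subst (T := fun _ => t) h).
Qed.

Lemma dterm_row n (T : (nat -> R) -> 'I_n -> R) j : dterm (fun e => T e j) ->
  dterm (fun e => (\row_i T e i) ord0 j).
Proof. by apply: dterm_ext => e; rewrite mxE. Qed.

End Definability.

Global Opaque dpred dterm.

Ltac definable_step hS :=
  cbv beta; try (move=> ?);
  first
  [ assumption
  | apply: (dterm_var hS) | apply: (dterm_const hS)
  | apply: (dterm_add hS) | apply: (dterm_mul hS) | apply: (dterm_opp hS)
  | apply: (dterm_norm hS) | apply: (dterm_sum hS) => ?
  | apply: dterm_row
  | apply: (dpred_const hS)
  | apply: (dpred_exists_row hS) | apply: (dpred_forall_row hS)
  | apply: (dpred_forall_ord hS) => ?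
  | apply: (dpred_exists hS) | apply: (dpred_forall hS)
  | apply: (dpred_lt hS) | apply: (dpred_le hS) | apply: (dpred_eq hS)
  | apply: (dpred_and hS) | apply: (dpred_or hS) | apply: (dpred_not hS)
  | apply: (dpred_iff2 hS) | apply: (dpred_imp hS) ].
Ltac definable hS := repeat definable_step hS.

(** * One-variable definable sets, and a uniform radius on discrete sets *)

Section LocalOMinimality.
Variables (R : realFieldType) (S : structure R).
Hypotheses (hS : is_structure S) (hdc : definably_complete S) (hlo : locally_o_minimal S).

Lemma dpred_rel n (G : 'rV[R]_n -> R -> Prop) (v : (nat -> R) -> 'rV[R]_n) t :
  dpred S (fun e => G (\row_i e i) (e n)) -> (forall i, dterm S (fun e => v e ord0 i)) ->
  dterm S t -> dpred S (fun e => G (v e) (t e)).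
Proof.
move=> hG hv ht.
pose T k e := if insub k is Some i then v e ord0 i else t e.
have hT k : dterm S (T k) by rewrite /T; case: insubP => [i _ _|_].
apply: dpred_iff (dpred_subst hS hG hT) => e.
suff -> : \row_(i < n) T i e = v e by rewrite /T insubF ?ltnn.
by apply/rowP => i; rewrite mxE /T valK.
Qed.

Lemma dpred_dset (A : R -> Prop) t : dpred S (fun e => A (e 0%N)) -> dterm S t ->
  dpred S (fun e => A (t e)).
Proof. by move=> hA ht; apply: (dpred_subst hS hA (T := fun _ => t)). Qed.

Lemma structure1 (A : R -> Prop) : dpred S (fun e => A (e 0%N)) ->
  S (fun x : 'rV[R]_1 => A (x ord0 ord0)).
Proof. by move=> h; apply: (structure_dpred hS); apply: dpred_iff h => e; rewrite mxE. Qed.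

Lemma definable_sup (A : R -> Prop) : dpred S (fun e => A (e 0%N)) ->
  (exists t, A t) -> (exists b, forall t, A t -> t <= b) ->
  exists s, (forall t, A t -> t <= s) /\ (forall b, (forall t, A t -> t <= b) -> s <= b).
Proof.
move=> /structure1 /hdc [h _]; move: h.
have E t : A (pt1 t ord0 ord0) = A t by rewrite mxE.
move=> h [t ht] [b hb]; case: h.
- by exists t; rewrite E.
- by exists b => u; rewrite E => /hb.
- move=> s [h1 h2]; exists s; split=> [u hu|c hc]; first by apply: h1; rewrite E.
  by apply: h2 => u; rewrite E => /hc.
Qed.

(** Induction along an interval, in place of compactness. At the supremum [s] of the good points,
    [hstep] carries [P] from a good point close to [s] past [s], so [s] can only be stopped by
    [b]. *)
Lemma definable_induction (P : R -> Prop) a b : dpred S (fun e => P (e 0%N)) ->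
  a <= b -> P a ->
  (forall s, a <= s -> s <= b -> exists2 d, 0 < d & forall x y, a <= x -> y <= b ->
     s - d < x -> x <= s -> s <= y -> y < s + d -> P x -> P y) ->
  P b.
Proof.
move=> hP hab Pa hstep.
have [] := @definable_sup (fun t => (a <= t /\ t <= b) /\ P t).
- by definable hS.
- by exists a.
- by exists b => t [[_ ->]].
move=> s [hs1 hs2].
have has : a <= s by apply: hs1.
have hsb : s <= b by apply: hs2 => t [[]].
have [d d0 hd] := hstep s has hsb.
have [x [[hx1 hx2] Px] hx] : exists2 x, (a <= x /\ x <= b) /\ P x & s - d < x.
  apply: NNPP => hn; suff : s <= s - d by lra.
  apply: hs2 => t ht; rewrite leNgt; apply/negP => htd; apply: hn; by exists t.
have hxs : x <= s by apply: hs1.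
have [hbs|hbs] := ltP b (s + d); first by apply: (hd x b).
have : P (s + d / 2) by apply: (hd x) => //; lra.
move=> hP'; have : s + d / 2 <= s by apply: hs1; split=> //; lra.
lra.
Qed.

Definition has_interior (A : R -> Prop) := exists a b, a < b /\ forall t, a < t -> t < b -> A t.

Lemma seq_gap (ps : seq R) a :
  exists2 d, 0 < d & forall t, t \in ps -> t != a -> d <= `|t - a|.
Proof.
elim: ps => [|p ps [d d0 hd]]; first by exists 1.
have [->|hpa] := eqVneq p a.
  by exists d => // t; rewrite in_cons => /orP [/eqP -> /eqP //|]; apply: hd.
exists (Num.min d `|p - a|); first by rewrite lt_min d0 normr_gt0 subr_eq0.
move=> t; rewrite in_cons => /orP [/eqP -> _|/hd h /h h']; first by rewrite ge_min lexx orbT.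
by rewrite ge_min h'.
Qed.

(** Near [a] the set is a finite union of points and intervals. An interval met there would give
    interior, so finitely many points remain, and those other than [a] keep a distance from it. *)
Lemma empty_interior_isolated (A : R -> Prop) a : dpred S (fun e => A (e 0%N)) ->
  ~ has_interior A -> exists2 d, 0 < d & forall t, t != a -> `|t - a| < d -> ~ A t.
Proof.
move=> hA hint; have [c [d [/andP [hca had] [ps [ivs h]]]]] := hlo (structure1 hA) a.
have [g g0 hg] := seq_gap ps a.
exists (Num.min g (Num.min (a - c) (d - a))); first by rewrite !lt_min; lra.
move=> t hta; rewrite !lt_min => /and3P [h1 h2 h3] At.
have hct : c < t by move: h2; rewrite ltr_norml; lra.
have htd : t < d by move: h3; rewrite ltr_norml; lra.
have hA' u : c < u -> u < d -> A u <-> (u \in ps) \/ has (fun p => (p.1 < u) && (u < p.2)) ivs.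
  by move=> ? ?; have := h u; rewrite mxE; apply; apply/andP.
have /(hA' _ hct htd) [/hg /(_ hta)|] := At; first by lra.
move=> /hasP [p hp /andP [p1 p2]]; apply: hint.
exists (Num.max c p.1), (Num.min d p.2); split; first by rewrite gt_max !lt_min; lra.
move=> u; rewrite gt_max lt_min => /andP [u1 u2] /andP [u3 u4].
by apply/hA' => //; right; apply/hasP; exists p => //; apply/andP.
Qed.

(** False for arbitrary sets, such as the rationals and the irrationals in the real line. If [A] has
    empty interior, it misses a punctured neighborhood of the midpoint of the given interval, and
    [B] has to fill the part to the right of the midpoint. *)
Lemma has_interior_or (A B : R -> Prop) : dpred S (fun e => A (e 0%N)) ->
  has_interior (fun t => A t \/ B t) -> has_interior A \/ has_interior B.
Proof.
move=> hA [a [b [hab h]]]; case: (classic (has_interior A)) => hiA; [by left | right].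
have [d d0 hd] := empty_interior_isolated ((a + b) / 2) hA hiA.
exists ((a + b) / 2), (Num.min b ((a + b) / 2 + d)); split; first by rewrite lt_min; lra.
move=> t h1; rewrite lt_min => /andP [h2 h3].
have := h t; case=> //; first by lra.
have ht : `|t - (a + b) / 2| < d by rewrite ltr_norml; lra.
move=> At; exfalso; apply: (hd t _ ht) => //.
by apply/eqP; lra.
Qed.

(* Induct on the number [k] of coordinates in which the points are separated.
   Inside a slab of width less than [eps] in coordinate [k], points are already
   separated in the first [k] coordinates; real induction glues the slabs. *)
Lemma separated_image_empty_interior n (eps M : R) (k : nat) :
  0 < eps -> (k <= n)%N ->
  forall G : 'rV[R]_n -> R -> Prop,
  dpred S (fun e => G (\row_i e i) (e n)) ->
  (forall y t i, G y t -> `|y ord0 i| <= M) ->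
  (forall y t t', G y t -> G y t' -> t = t') ->
  (forall y y' t t', G y t -> G y' t' -> y <> y' ->
     exists i : 'I_n, (i < k)%N /\ eps <= `|y ord0 i - y' ord0 i|) ->
  ~ has_interior (fun t => exists y, G y t).
Proof.
move=> eps0; elim: k => [|k IH] hk G hG hM hf hsep.
  move=> [a [b [hab h]]].
  (* With no coordinate to separate points there is at most one point, hence one value, but an
     interval contains two. *)
  have [||y hy] := h ((2 * a + b) / 3); [by lra..|].
  have [||y' hy'] := h ((a + 2 * b) / 3); [by lra..|].
  have [E|/(hsep _ _ _ _ hy hy') [i []] //] := classic (y = y').
  by subst y'; have := hf _ _ _ hy hy'; lra.
pose K := Ordinal hk.
pose slab (P : R -> Prop) (y : 'rV[R]_n) t := G y t /\ P (y ord0 K).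
have hslab (P : R -> Prop) : dpred S (fun e => P (e 0%N)) ->
    dpred S (fun e => slab P (\row_i e i) (e n)).
  move=> hP; apply: (dpred_and hS) => //.
  by apply: (dpred_dset hP); definable hS.
have hle c : dpred S (fun e => e 0%N <= c) by definable hS.
have hproj G' : dpred S (fun e => G' (\row_(i < n) e i) (e n)) ->
    dpred S (fun e => exists y : 'rV[R]_n, G' y (e 0%N)).
  move=> hG'; definable_step hS; apply: (dpred_rel hG'); definable hS.
suff h : ~ has_interior (fun t => exists y, slab (fun x => x <= `|M|) y t).
  move=> [a [b [hab h']]]; apply: h; exists a, b; split=> // t h1 h2.
  case: (h' t h1 h2) => y hy; exists y; split=> //.
  by apply: le_trans (ler_norm _) (le_trans (hM _ _ K hy) (ler_norm _)).
(* The start lies below all points, where the slab is empty, and the end above them; [M] can be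
   negative if there are no points, hence [|M|]. *)
have := @definable_induction (fun c => ~ has_interior (fun t => exists y, slab (fun x => x <= c) y t))
  (- `|M| - 1) `|M|; apply.
- definable_step hS; rewrite /has_interior /slab; definable hS.
  by apply: (dpred_rel hG); definable hS.
- by have := normr_ge0 M; lra.
- move=> [a [b [hab h]]]; have [||y [hy]] := h ((a + b) / 2); [by lra..|].
  by have := hM _ _ K hy; have := ler_norm M; rewrite ler_norml; lra.
(* The slab around [s] has width [2 * eps / 3], so coordinate [k] separates no two of its points and
   [IH] applies. *)
move=> s _ _; exists (eps / 3); first by lra.
move=> x y _ _ h1 h2 h3 h4 hx hy.
have hI : ~ has_interior (fun t => exists z, slab (fun c => s - eps / 3 < c /\ c < s + eps / 3) z t).
  apply: IH.
  - exact: ltnW.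
  - by apply: hslab; definable hS.
  - by move=> z t i [hz _]; apply: hM hz.
  - by move=> z t t' [hz _] [hz' _]; apply: hf hz hz'.
  - move=> z z' t t' [hz [c1 c2]] [hz' [c1' c2']] /(hsep _ _ _ _ hz hz') [i [hi he]].
    exists i; split=> //; move: hi; rewrite ltnS leq_eqVlt => /orP [/eqP hi|//].
    have Ei : i = K by apply: val_inj.
    move: he; rewrite Ei => he; have : `|z ord0 K - z' ord0 K| < eps by rewrite ltr_norml; lra.
    by lra.
have [] // := @has_interior_or (fun t => exists z, slab (fun c => c <= x) z t)
  (fun t => exists z, slab (fun c => s - eps / 3 < c /\ c < s + eps / 3) z t)
  (hproj _ (hslab (fun c => c <= x) (hle x))).
case: hy => a [b [hab h]]; exists a, b; split=> // t ta tb.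
case: (h t ta tb) => z [hz hc].
have [hzx|hzx] := leP (z ord0 K) x; [left | right]; exists z; split=> //; lra.
Qed.

(* [h y := sup {e | Q y e}] takes arbitrarily small values if the conclusion
   fails; by local o-minimality its range then contains an interval, although
   the points with [h y] bounded below form a separated bounded set. *)
Lemma uniform_radius n (Q : 'rV[R]_n -> R -> Prop) (D : 'rV[R]_n -> Prop) :
  dpred S (fun e => Q (\row_i e i) (e n)) ->
  S D ->
  (forall y, D y -> exists2 d, 0 < d & forall e, 0 < e -> e <= d -> Q y e) ->
  (forall y e e', Q y e -> 0 < e' -> e' <= e -> Q y e') ->
  (forall y, D y -> exists2 d, 0 < d &
     forall y', D y' -> y' <> y -> exists i, d <= `|y' ord0 i - y ord0 i|) ->
  exists2 e, 0 < e & forall y, D y -> Q y e.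
Proof.
move=> hQ hD hQ0 hQm hsep; apply: NNPP => hn.
pose sep (y : 'rV[R]_n) e := forall y' : 'rV[R]_n, D y' -> (forall i, `|y' ord0 i - y ord0 i| < e) ->
  forall i, y' ord0 i = y ord0 i.
(* The conditions added to [Q] bound the supremum of the radii at [y], and force the points where it
   exceeds a given [c > 0] to be [c]-separated with coordinates at most [c^-1], as
   [separated_image_empty_interior] requires. *)
pose P (y : 'rV[R]_n) e := (0 < e /\ e < 1) /\ (forall i, e * `|y ord0 i| <= 1) /\ sep y e /\ Q y e.
have hP : dpred S (fun e => P (\row_i e i) (e n)).
  rewrite /P /sep; definable hS.
  by apply: (dpred_structure hS hD); definable hS.
pose lub (y : 'rV[R]_n) s := (forall e, P y e -> e <= s) /\ (forall b, (forall e, P y e -> e <= b) -> s <= b).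
have hlub : dpred S (fun e => lub (\row_i e i) (e n)).
  by rewrite /lub; repeat first [apply: (dpred_rel hP) | definable_step hS].
have Pm y e e' : P y e -> 0 < e' -> e' <= e -> P y e'.
  move=> [[e0 e1] [hb [hs hq]]] e'0 he'; split; first by lra.
  split; last split.
  - by move=> i; apply: le_trans (hb i); rewrite ler_wpM2r.
  - by move=> y' Dy' hy'; apply: hs => // i; apply: lt_le_trans he'.
  - exact: hQm hq _ _.
have P0 y : D y -> exists e, P y e.
  move=> Dy; have [d1 d10 hd1] := hQ0 y Dy; have [d2 d20 hd2] := hsep y Dy.
  have [M M0 hM] : exists2 M, 0 < M & forall i, `|y ord0 i| <= M.
    exists (1 + \sum_i `|y ord0 i|); first by rewrite ltr_wpDr // sumr_ge0.
    by move=> i; rewrite (bigD1 i) //= addrCA lerDl addr_ge0 // sumr_ge0.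
  pose e := Num.min (Num.min d1 d2) (Num.min (1 / 2) (M^-1)).
  have [e0 [ed1 [ed2 [e2 eM]]]] : 0 < e /\ e <= d1 /\ e <= d2 /\ e <= 1 / 2 /\ e <= M^-1.
    have hM0 : 0 < M^-1 by rewrite invr_gt0.
    rewrite /e; repeat split; rewrite ?lt_min ?ge_min ?lexx ?orbT //; lra.
  exists e; split; first by lra.
  split; [|split; last exact: hd1].
    move=> i; apply: (@le_trans _ _ (M^-1 * M)); last by rewrite mulVf // gt_eqF.
    by apply: ler_pM => //; apply: ltW.
  move=> y' Dy' hy' i; have [-> //|hne] := classic (y' = y).
  have [j hj] := hd2 _ Dy' hne; have := hy' j; lra.
have lub_ex y : D y -> exists2 s, lub y s & 0 < s.
  move=> Dy; have [e he] := P0 y Dy.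
  have [] := @definable_sup (P y).
  - by apply: (dpred_rel hP); definable hS.
  - by exists e.
  - by exists 1 => t [[_ /ltW]].
  move=> s hs; exists s => //; case: hs => /(_ e he) h _.
  by case: he => [[e0 _] _]; lra.
have lub_P y s e : lub y s -> 0 < e -> e < s -> P y e.
  move=> [_ h] e0 es; apply: NNPP => hPe; suff : s <= e by lra.
  apply: h => f Pf; rewrite leNgt; apply/negP => hf; apply: hPe; apply: Pm Pf _ _ => //; exact: ltW.
pose E s := 0 < s /\ exists y : 'rV[R]_n, D y /\ lub y s.
have hE : dpred S (fun e => E (e 0%N)).
  by repeat first [apply: (dpred_structure hS hD) | apply: (dpred_rel hlub) | definable_step hS].
have [a [b [hab hEab]]] : has_interior E.
  (* Otherwise 0 is isolated from the range [E]: all suprema are at least some [d], and [d / 2] is a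
     uniform radius. *)
  apply: NNPP => hni; have [d d0 hd] := empty_interior_isolated 0 hE hni.
  apply: hn; exists (d / 2); first by lra.
  move=> y Dy; have [s hs s0] := lub_ex y Dy.
  have [hsd|hsd] := ltP s d.
    exfalso; apply: (hd s); [by rewrite gt_eqF | by rewrite subr0 gtr0_norm |].
    by split=> //; exists y.
  by have [_ [_ [_ h]]] : P y (d / 2) by apply: lub_P hs _ _; lra.
have b0 : 0 < b by have [||h _] := hEab ((a + b) / 2); lra.
(* Besides lying in the interval, [c] must be positive: it becomes the separation constant, and its
   inverse the bound on coordinates. *)
pose c := (Num.max a 0 + b) / 2.
have [c0 [ac cb]] : 0 < c /\ a < c /\ c < b.
  have : Num.max a 0 < b by rewrite gt_max hab b0.
  have : a <= Num.max a 0 by rewrite le_max lexx.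
  have : 0 <= Num.max a 0 by rewrite le_max lexx orbT.
  by rewrite /c; move: (Num.max a 0) => m; lra.
have := @separated_image_empty_interior n c c^-1 n c0 (leqnn n)
  (fun y s => (c < s /\ D y) /\ lub y s); apply.
- by repeat first [apply: (dpred_structure hS hD) | apply: (dpred_rel hlub) | definable_step hS].
- move=> y t i [[ct _] /lub_P /(_ c0 ct) [_ [h _]]].
  by rewrite -[c^-1]mul1r ler_pdivlMr // mulrC.
- move=> y t t' [_ [h1 h2]] [_ [h1' h2']]; apply/eqP; rewrite eq_le.
  by rewrite h2 ?h2'.
- move=> y y' t t' [[ct Dy] /lub_P /(_ c0 ct) [_ [_ [hs _]]]] [[ct' Dy'] _] hne.
  apply: NNPP => hno; apply: hne; apply/rowP => i; rewrite (hs y' Dy') // => j.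
  by rewrite ltNge distrC; apply/negP => hj; apply: hno; exists j.
exists c, b; split=> // t h1 h2; have [|//|_ [y [Dy hy]]] := hEab t; first by lra.
by exists y.
Qed.

End LocalOMinimality.

(** * Sup norm and continuity *)

Section Norm.
Variable R : realFieldType.

Definition nrm n (x : 'rV[R]_n) : R := \big[Num.max/0]_i `|x ord0 i|.

Lemma nrm_ge0 n (x : 'rV[R]_n) : 0 <= nrm x.
Proof. exact: bigmax_ge_id. Qed.

Lemma le_nrm n (x : 'rV[R]_n) i : `|x ord0 i| <= nrm x.
Proof. exact: (le_bigmax 0 (fun i => `|x ord0 i|)). Qed.

Lemma nrm_le n (x : 'rV[R]_n) m : 0 <= m -> (forall i, `|x ord0 i| <= m) -> nrm x <= m.
Proof. by move=> m0 h; apply: bigmax_le. Qed.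

Lemma nrm_lt n (x : 'rV[R]_n) m : 0 < m -> (forall i, `|x ord0 i| < m) -> nrm x < m.
Proof. by move=> m0 h; apply: bigmax_lt. Qed.

Lemma nrm0 n : nrm (0 : 'rV[R]_n) = 0.
Proof. by apply/eqP; rewrite eq_le nrm_ge0 nrm_le // => i; rewrite mxE normr0. Qed.

Lemma nrmN n (x : 'rV[R]_n) : nrm (- x) = nrm x.
Proof. by apply: eq_bigr => i _; rewrite mxE normrN. Qed.

Lemma nrmB n (x y : 'rV[R]_n) : nrm (x - y) = nrm (y - x).
Proof. by rewrite -nrmN opprB. Qed.

Lemma nrmD n (x y : 'rV[R]_n) : nrm (x + y) <= nrm x + nrm y.
Proof.
apply: nrm_le => [|i]; first by rewrite addr_ge0 ?nrm_ge0.
by rewrite mxE (le_trans (ler_normD _ _)) // lerD ?le_nrm.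
Qed.

Lemma nrm_triangle n (x y z : 'rV[R]_n) : nrm (x - z) <= nrm (x - y) + nrm (y - z).
Proof. by rewrite (le_trans _ (nrmD _ _)) // addrA subrK. Qed.

Lemma nrmZ n a (x : 'rV[R]_n) : nrm (a *: x) <= `|a| * nrm x.
Proof.
apply: nrm_le => [|i]; first by rewrite mulr_ge0 ?nrm_ge0.
by rewrite mxE normrM ler_wpM2l // le_nrm.
Qed.

Lemma nrm_eq0 n (x : 'rV[R]_n) : nrm x <= 0 -> x = 0.
Proof.
move=> h; apply/rowP => i; apply/eqP; rewrite mxE -normr_eq0 eq_le normr_ge0 andbT.
exact: le_trans (le_nrm _ _) h.
Qed.

Lemma common_radius (I : finType) (P : I -> R -> Prop) :
  (forall i, exists2 d, 0 < d & P i d) ->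
  (forall i d d', P i d -> 0 < d' -> d' <= d -> P i d') ->
  exists2 d, 0 < d & forall i, P i d.
Proof.
move=> h hm.
suff [d d0 hd] : exists2 d, 0 < d & forall i, i \in enum I -> P i d.
  by exists d => // i; apply: hd; rewrite mem_enum.
elim: (enum I) => [|i s [d d0 hd]]; first by exists 1.
have [d' d'0 hd'] := h i; exists (Num.min d d'); first by rewrite lt_min d0.
have h0 : 0 < Num.min d d' by rewrite lt_min d0.
move=> j; rewrite in_cons => /orP [/eqP ->|/hd hj].
  by apply: hm hd' _ _ => //; rewrite ge_min lexx orbT.
by apply: hm hj _ _ => //; rewrite ge_min lexx.
Qed.

End Norm.

Section Continuity.
Variable R : realFieldType.

Definition continuous_at n (f : 'rV[R]_n -> R) x :=
  forall e, 0 < e -> exists2 d, 0 < d & forall y, nrm (y - x) < d -> `|f y - f x| < e.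

Section Fixed.
Variable n : nat.
Implicit Types (f g : 'rV[R]_n -> R) (x : 'rV[R]_n).

Lemma continuous_at_local f g x d : 0 < d -> (forall y, nrm (y - x) < d -> f y = g y) ->
  continuous_at f x -> continuous_at g x.
Proof.
move=> d0 h hf e /hf [d' d'0 hd]; exists (Num.min d d'); first by rewrite lt_min d0.
move=> y; rewrite lt_min => /andP [h1 h2].
by rewrite -!h ?hd // subrr nrm0.
Qed.

Lemma continuous_at_ext f g x : f =1 g -> continuous_at f x -> continuous_at g x.
Proof. by move=> h; apply: (@continuous_at_local _ _ _ 1). Qed.

Lemma continuous_at_const c x : continuous_at (fun _ => c) x.
Proof. by move=> e e0; exists 1 => // y _; rewrite subrr normr0. Qed.

Lemma continuous_at_coord i x : continuous_at (fun y => y ord0 i) x.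
Proof.
move=> e e0; exists e => // y; apply: le_lt_trans.
by have := le_nrm (y - x) i; rewrite !mxE.
Qed.

Lemma continuous_at_add f g x :
  continuous_at f x -> continuous_at g x -> continuous_at (fun y => f y + g y) x.
Proof.
move=> hf hg e e0.
have [|d1 d10 h1] := hf (e / 2); first by lra.
have [|d2 d20 h2] := hg (e / 2); first by lra.
exists (Num.min d1 d2); first by rewrite lt_min d10.
move=> y; rewrite lt_min => /andP [/h1 ha /h2 hb].
have -> : f y + g y - (f x + g x) = (f y - f x) + (g y - g x) by ring.
by apply: le_lt_trans (ler_normD _ _) _; lra.
Qed.

Lemma continuous_at_mul f g x :
  continuous_at f x -> continuous_at g x -> continuous_at (fun y => f y * g y) x.
Proof.
move=> hf hg e e0.
have hF : 0 < `|f x| + 1 by rewrite ltr_wpDl.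
have hG : 0 < `|g x| + 1 by rewrite ltr_wpDl.
have [|d1 d10 h1] := hf (e / 2 / (`|g x| + 1)); first by rewrite !divr_gt0.
have [|d2 d20 h2] := hg (Num.min 1 (e / 2 / (`|f x| + 1))); first by rewrite lt_min ltr01 !divr_gt0.
exists (Num.min d1 d2); first by rewrite lt_min d10.
move=> y; rewrite lt_min => /andP [/h1 ha /h2]; rewrite lt_min => /andP [hb hc].
have -> : f y * g y - f x * g x = (f y - f x) * g y + f x * (g y - g x) by ring.
apply: le_lt_trans (ler_normD _ _) _; rewrite !normrM.
have hgy : `|g y| <= `|g x| + 1.
  by have := ler_normD (g x) (g y - g x); rewrite addrC subrK; lra.
have A : `|f y - f x| * `|g y| <= `|f y - f x| * (`|g x| + 1) by rewrite ler_wpM2l.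
have B : `|f y - f x| * (`|g x| + 1) < e / 2 by rewrite -ltr_pdivlMr.
have C : `|g y - g x| * (`|f x| + 1) < e / 2 by rewrite -ltr_pdivlMr.
have D : `|f x| * `|g y - g x| <= `|g y - g x| * (`|f x| + 1).
  by rewrite mulrC ler_wpM2l // lerDl ler01.
by lra.
Qed.

Lemma continuous_at_inv f x : f x != 0 ->
  continuous_at f x -> continuous_at (fun y => (f y)^-1) x.
Proof.
move=> f0 hf e e0; have F0 : 0 < `|f x| by rewrite normr_gt0.
have [|d d0 h] := hf (Num.min (`|f x| / 2) (e * (`|f x| * (`|f x| / 2)))).
  have F2 : 0 < `|f x| / 2 by lra.
  by rewrite lt_min F2 (mulr_gt0 e0) ?(mulr_gt0 F0 F2).
exists d => // y /h; rewrite lt_min => /andP [h1 h2].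
have hy : `|f x| / 2 < `|f y|.
  by have := ler_normD (f x - f y) (f y); rewrite subrK distrC; lra.
have fy0 : f y != 0 by rewrite -normr_gt0; lra.
have -> : (f y)^-1 - (f x)^-1 = (f x - f y) / (f x * f y) by field; rewrite f0 fy0.
rewrite normrM normfV normrM ltr_pdivrMr; last by rewrite mulr_gt0 // normr_gt0.
rewrite distrC; apply: lt_le_trans h2 _.
by rewrite ler_pM2l // ler_pM2l // ltW.
Qed.

Lemma continuous_at_sum (I : Type) (s : seq I) (F : I -> 'rV[R]_n -> R) x :
  (forall i, continuous_at (F i) x) -> continuous_at (fun y => \sum_(i <- s) F i y) x.
Proof.
move=> h; elim: s => [|i s IH].
  by apply: continuous_at_ext (continuous_at_const 0 x) => y; rewrite big_nil.
by apply: continuous_at_ext (continuous_at_add (h i) IH) => y; rewrite big_cons.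
Qed.

Lemma continuous_row_at m (g : 'rV[R]_n -> 'rV[R]_m) x :
  (forall i, continuous_at (fun y => g y ord0 i) x) ->
  forall e, 0 < e -> exists2 d, 0 < d & forall y, nrm (y - x) < d -> nrm (g y - g x) < e.
Proof.
move=> hg e e0.
have [||d d0 hd] := @common_radius R 'I_m
  (fun i d => forall y, nrm (y - x) < d -> `|g y ord0 i - g x ord0 i| < e).
- by move=> i; apply: hg.
- by move=> i d d' h _ hd y hy; apply: h; apply: lt_le_trans hd.
exists d => // y hy; apply: nrm_lt => // i; rewrite !mxE; exact: hd.
Qed.

End Fixed.

Lemma continuous_at_comp n m (f : 'rV[R]_m -> R) (g : 'rV[R]_n -> 'rV[R]_m) x :
  continuous_at f (g x) -> (forall i, continuous_at (fun y => g y ord0 i) x) ->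
  continuous_at (fun y => f (g y)) x.
Proof.
move=> hf hg e /hf [d d0 hd]; have [d' d'0 hd'] := continuous_row_at hg d0.
by exists d' => // y /hd' /hd.
Qed.

End Continuity.

(* Applied both to functions continuous at a point and to [C^r] functions. *)
Section FunctionRing.
Variables (R : realFieldType) (T : Type) (C : (T -> R) -> Prop).
Hypotheses (Cext : forall f g, f =1 g -> C f -> C g) (Cconst : forall c, C (fun _ => c))
  (Cadd : forall f g, C f -> C g -> C (fun t => f t + g t))
  (Cmul : forall f g, C f -> C g -> C (fun t => f t * g t)).

Lemma closed_sum (I : Type) (s : seq I) (F : I -> T -> R) :
  (forall i, C (F i)) -> C (fun t => \sum_(i <- s) F i t).
Proof.
move=> h; elim: s => [|i s IH].
  by apply: Cext (Cconst 0) => t; rewrite big_nil.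
by apply: Cext (Cadd (h i) IH) => t; rewrite big_cons.
Qed.

Lemma closed_prod (I : Type) (s : seq I) (F : I -> T -> R) :
  (forall i, C (F i)) -> C (fun t => \prod_(i <- s) F i t).
Proof.
move=> h; elim: s => [|i s IH].
  by apply: Cext (Cconst 1) => t; rewrite big_nil.
by apply: Cext (Cmul (h i) IH) => t; rewrite big_cons.
Qed.

Lemma closed_det m (M : T -> 'M[R]_m) : (forall i j, C (fun t => M t i j)) ->
  C (fun t => \det (M t)).
Proof.
move=> h; apply: closed_sum => s; apply: Cmul; first exact: Cconst.
by apply: closed_prod.
Qed.

(** Cofactors are polynomials in the entries. The inverse determinant is a separate hypothesis,
    since inversion preserves continuity or smoothness only where the determinant does not
    vanish. *)
Lemma closed_cramer m (M : T -> 'M[R]_m) : (forall i j, C (fun t => M t i j)) ->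
  C (fun t => (\det (M t))^-1) ->
  forall i j, C (fun t => ((\det (M t))^-1 *: \adj (M t)) i j).
Proof.
move=> h hdet i j.
have hadj : C (fun t => (\adj (M t)) i j).
  suff : C (fun t => (-1) ^+ (j + i) * \det (row' j (col' i (M t)))).
    by apply: Cext => t; rewrite mxE.
  apply: Cmul; first exact: (Cconst ((-1) ^+ (j + i))).
  by apply: closed_det => k l; apply: Cext (h (lift j k) (lift i l)) => t; rewrite !mxE.
by apply: Cext (Cmul hdet hadj) => t; rewrite [RHS]mxE.
Qed.

End FunctionRing.

(** * Differentials and the chain rule *)

Section Differentials.
Variable R : realFieldType.

(* Caratheodory's form of differentiability: it turns the chain rule and the
   derivative of an inverse into algebra with continuous functions. *)
Definition has_diff n (f : 'rV[R]_n -> R) (x : 'rV[R]_n) (L : 'I_n -> R) :=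
  exists phi : 'I_n -> 'rV[R]_n -> R,
    (forall k, continuous_at (phi k) 0 /\ phi k 0 = L k) /\
    exists2 d, 0 < d & forall h, nrm h < d -> f (x + h) = f x + \sum_k phi k h * h ord0 k.

Lemma frechet_has_diff n (J : Type) (f : 'rV[R]_n -> J -> R) x L j :
  frechet f x L -> has_diff (fun y => f y j) x (fun k => L (j, k)).
Proof.
move=> hF.
pose rem h := f (x + h) j - f x j - \sum_(k < n) L (j, k) * h ord0 k.
pose l1 (h : 'rV[R]_n) := \sum_(k < n) `|h ord0 k|.
have l10 h : 0 <= l1 h by apply: sumr_ge0.
(* The remainder is shared among the coordinates in such a way that the identity
   [sg (h_k) * h_k = |h_k|] sums it up again. At [h = 0] the extra term vanishes because the sign of
   0 is 0. *)
exists (fun k h => L (j, k) + rem h * Num.sg (h ord0 k) / l1 h); split; last first.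
  exists 1 => // h _; have [hl|hl] := eqVneq (l1 h) 0.
    suff -> : h = 0 by rewrite addr0 big1 ?addr0 // => k _; rewrite mxE mulr0.
    apply/rowP => k; apply/eqP; rewrite mxE -normr_eq0 eq_le normr_ge0 andbT -hl.
    by rewrite /l1 (bigD1 k) //= lerDl sumr_ge0.
  rewrite (eq_bigr (fun k => L (j, k) * h ord0 k + rem h / l1 h * `|h ord0 k|)); last first.
    by move=> k _; rewrite [`|h ord0 k|]normrEsg; ring.
  by rewrite big_split /= -mulr_sumr divfK // /rem; ring.
move=> k; split; last first.
  by rewrite mxE sgr0 mulr0 mul0r addr0.
move=> e e0; have [|d [d0 hd]] := hF (e / 2); first by lra.
exists d => // h; rewrite subr0 => hh.
have {}hd := hd h (fun k => le_lt_trans (le_nrm h k) hh) j.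
rewrite mxE sgr0 mulr0 mul0r addr0 addrC addKr.
rewrite -/(rem h) -/(l1 h) in hd.
have [hl|hl] := eqVneq (l1 h) 0; first by rewrite hl invr0 mulr0 normr0.
have hl' : 0 < l1 h by rewrite lt_def hl l10.
rewrite normrM normfV (gtr0_norm hl') ltr_pdivrMr // normrM.
apply: (@le_lt_trans _ _ (e / 2 * l1 h)); last by rewrite ltr_pM2r //; lra.
apply: le_trans hd; rewrite ler_piMr // normr_sg.
by case: (_ == _).
Qed.

Lemma has_diff_frechet n (J : finType) (f : 'rV[R]_n -> J -> R) x L :
  (forall j, has_diff (fun y => f y j) x (fun k => L (j, k))) -> frechet f x L.
Proof.
move=> hf e e0.
have [||d d0 hd] := @common_radius R J (fun j d => forall h : 'rV[R]_n, nrm h < d ->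
    `|f (x + h) j - f x j - \sum_(k < n) L (j, k) * h ord0 k| <= e * \sum_(k < n) `|h ord0 k|).
- move=> j; have [phi [hphi [d d0 hd]]] := hf j.
  have [||d' d'0 hd'] := @common_radius R 'I_n (fun k d => forall h, nrm h < d -> `|phi k h - phi k 0| < e).
  + move=> k; have [h _] := hphi k; have [d' d'0 hd'] := h e e0.
    by exists d' => // u hu; apply: hd'; rewrite subr0.
  + by move=> k a b h _ hab u hu; apply: h; apply: lt_le_trans hab.
  exists (Num.min d d'); first by rewrite lt_min d0.
  move=> h; rewrite lt_min => /andP [/hd h1 h2]; rewrite h1.
  have -> : f x j + \sum_k phi k h * h ord0 k - f x j - \sum_k L (j, k) * h ord0 k =
      \sum_k (phi k h - phi k 0) * h ord0 k.
    rewrite [f x j + _]addrC addrK -sumrB; apply: eq_bigr => k _.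
    by have [_ ->] := hphi k; rewrite mulrBl.
  apply: le_trans (ler_norm_sum _ _ _) _; rewrite mulr_sumr; apply: ler_sum => k _.
  by rewrite normrM ler_wpM2r // ltW // hd'.
- by move=> j a b h _ hab u hu; apply: h; apply: lt_le_trans hab.
by exists d; split=> // h hh j; apply: hd; apply: nrm_lt.
Qed.

Section Fixed.
Variable n : nat.
Implicit Types (f g : 'rV[R]_n -> R) (x : 'rV[R]_n) (L M : 'I_n -> R).

Lemma has_diff_local f g x L d : 0 < d -> (forall y, nrm (y - x) < d -> f y = g y) ->
  has_diff f x L -> has_diff g x L.
Proof.
move=> d0 hfg [phi [hphi [d' d'0 hd]]]; exists phi; split=> //.
exists (Num.min d d'); first by rewrite lt_min d0.
move=> h; rewrite lt_min => /andP [h1 h2].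
by rewrite -!hfg ?hd // ?subrr ?nrm0 // addrC addKr.
Qed.

Lemma has_diff_ext f g x L M : f =1 g -> L =1 M -> has_diff f x L -> has_diff g x M.
Proof.
move=> hfg hLM hf; have -> : M = L by apply: functional_extensionality => k; rewrite hLM.
exact: (@has_diff_local f g x L 1).
Qed.

Lemma has_diff_continuous f x L : has_diff f x L -> continuous_at f x.
Proof.
move=> [phi [hphi [d d0 hd]]].
apply: (@continuous_at_local _ _ (fun y => f x + \sum_k phi k (y - x) * (y ord0 k - x ord0 k)) _ _ d) => //.
  move=> y /hd; rewrite [x + _]addrC subrK => ->; congr (_ + _).
  by apply: eq_bigr => k _; rewrite !mxE.
have hB i : continuous_at (fun y => (y - x) ord0 i) x.
  apply: continuous_at_ext (continuous_at_add (continuous_at_coord i x) (continuous_at_const (- x ord0 i) x)).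
  by move=> y; rewrite !mxE.
apply: continuous_at_add; first exact: continuous_at_const.
apply: continuous_at_sum => k; apply: continuous_at_mul.
  by apply: (@continuous_at_comp R n n (phi k) (fun y => y - x)) => //; rewrite subrr; case: (hphi k).
by apply: continuous_at_ext (hB k) => y; rewrite !mxE.
Qed.

Lemma has_diff_unique f x L M : has_diff f x L -> has_diff f x M -> L =1 M.
Proof.
move=> [phi [hphi [d d0 hd]]] [psi [hpsi [d' d'0 hd']]] k.
have [hc h0] := hphi k; have [hc' h0'] := hpsi k; rewrite -h0 -h0'.
apply/eqP; rewrite -subr_eq0 -normr_le0 leNgt; apply/negP => hpos.
set c := `|_| in hpos.
have [|d1 d10 h1] := hc (c / 2); first by lra.
have [|d2 d20 h2] := hc' (c / 2); first by lra.
pose m := Num.min (Num.min d d') (Num.min d1 d2).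
have m0 : 0 < m by rewrite !lt_min d0 d'0 d10 d20.
pose t := m / 2; pose h : 'rV[R]_n := \row_j (if j == k then t else 0).
have hh : nrm h < m.
  by apply: nrm_lt => // j; rewrite mxE; case: ifP => _; rewrite ?normr0 // gtr0_norm /t; lra.
have S (F : 'I_n -> R) : \sum_j F j * h ord0 j = F k * t.
  rewrite (bigD1 k) //= mxE eqxx big1 ?addr0 // => j /negbTE hj.
  by rewrite mxE hj mulr0.
move: (hh); rewrite !lt_min => /andP [/andP [hd1 hd2] /andP [hd3 hd4]].
have := hd' _ hd2; rewrite hd // !S => /addrI /mulIf hE.
have {}hE : phi k h = psi k h by apply: hE; rewrite gt_eqF // /t; lra.
have := h1 h; rewrite subr0 => /(_ hd3) A; have := h2 h; rewrite subr0 => /(_ hd4) B.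
have : c <= `|phi k h - phi k 0| + `|psi k h - psi k 0|.
  rewrite /c; have -> : phi k 0 - psi k 0 = (psi k h - psi k 0) - (phi k h - phi k 0) by rewrite hE; ring.
  by rewrite -[`|phi k h - _|]normrN addrC ler_normD.
lra.
Qed.

Lemma has_diff_const c x : has_diff (fun _ => c) x (fun _ => 0).
Proof.
exists (fun _ _ => 0); split; first by move=> k; split=> //; apply: continuous_at_const.
by exists 1 => // h _; rewrite big1 ?addr0 // => k _; rewrite mul0r.
Qed.

Lemma has_diff_coord i x : has_diff (fun y => y ord0 i) x (fun k => (k == i)%:R).
Proof.
exists (fun k _ => (k == i)%:R); split; first by move=> k; split=> //; apply: continuous_at_const.
exists 1 => // h _; rewrite mxE; congr (_ + _).
by rewrite (bigD1 i) //= eqxx mul1r big1 ?addr0 // => k /negbTE ->; rewrite mul0r.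
Qed.

Lemma has_diff_add f g x L M : has_diff f x L -> has_diff g x M ->
  has_diff (fun y => f y + g y) x (fun k => L k + M k).
Proof.
move=> [phi [hphi [d d0 hd]]] [psi [hpsi [d' d'0 hd']]].
exists (fun k h => phi k h + psi k h); split.
  move=> k; have [h1 h2] := hphi k; have [h1' h2'] := hpsi k.
  by rewrite h2 h2'; split=> //; apply: continuous_at_add.
exists (Num.min d d'); first by rewrite lt_min d0.
move=> h; rewrite lt_min => /andP [/hd -> /hd' ->].
rewrite addrACA -big_split /=; congr (_ + _).
by apply: eq_bigr => k _; rewrite mulrDl.
Qed.

Lemma has_diff_shift f x L : has_diff f x L -> continuous_at (fun h => f (x + h)) 0.
Proof.
move=> hf; apply: (@continuous_at_comp R n n f (fun h => x + h)) => [|i].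
  by rewrite addr0; apply: has_diff_continuous hf.
apply: continuous_at_ext (continuous_at_add (continuous_at_const (x ord0 i) 0) (continuous_at_coord i 0)) => h.
by rewrite mxE.
Qed.

Lemma has_diff_mul f g x L M : has_diff f x L -> has_diff g x M ->
  has_diff (fun y => f y * g y) x (fun k => L k * g x + f x * M k).
Proof.
move=> hf hg; have hgc := has_diff_shift hg.
move: hf hg => [phi [hphi [d d0 hd]]] [psi [hpsi [d' d'0 hd']]].
exists (fun k h => phi k h * g (x + h) + f x * psi k h); split.
  move=> k; have [h1 h2] := hphi k; have [h1' h2'] := hpsi k.
  rewrite h2 h2' addr0; split=> //; apply: continuous_at_add; apply: continuous_at_mul => //.
  exact: continuous_at_const.
exists (Num.min d d'); first by rewrite lt_min d0.
move=> h; rewrite lt_min => /andP [h1 h2].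
have -> : \sum_k (phi k h * g (x + h) + f x * psi k h) * h ord0 k =
   (\sum_k phi k h * h ord0 k) * g (x + h) + f x * (\sum_k psi k h * h ord0 k).
  by rewrite mulr_suml mulr_sumr -big_split /=; apply: eq_bigr => k _; ring.
by rewrite hd // hd' //; ring.
Qed.

Lemma has_diff_inv f x L : f x != 0 -> has_diff f x L ->
  has_diff (fun y => (f y)^-1) x (fun k => - L k * (f x)^-1 * (f x)^-1).
Proof.
move=> f0 hf; have hfc := has_diff_shift hf; have hfx := has_diff_continuous hf.
move: hf => [phi [hphi [d d0 hd]]].
exists (fun k h => - phi k h * (f x)^-1 * (f (x + h))^-1); split.
  move=> k; have [h1 h2] := hphi k; rewrite h2 addr0; split=> //.
  apply: continuous_at_mul; last by apply: continuous_at_inv; rewrite // addr0.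
  apply: continuous_at_mul; last exact: continuous_at_const.
  apply: continuous_at_ext (continuous_at_mul (continuous_at_const (-1) 0) h1) => h.
  by rewrite mulN1r.
have [|d' d'0 hd'] := hfx `|f x|; first by rewrite normr_gt0.
exists (Num.min d d'); first by rewrite lt_min d0.
move=> h; rewrite lt_min => /andP [h1 h2].
have fh0 : f (x + h) != 0.
  apply/eqP => E; have := hd' (x + h).
  by rewrite addrAC subrr add0r E sub0r normrN ltxx => /(_ h2).
rewrite (eq_bigr (fun k => - (f x)^-1 * (f (x + h))^-1 * (phi k h * h ord0 k))); last by move=> k _; ring.
rewrite -mulr_sumr; have := hd h h1; move: fh0; set W := \sum_k _; set F := f (x + h) => F0 EF.
have -> : W = F - f x by rewrite EF; ring.
by field; rewrite f0 F0.
Qed.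

End Fixed.

(** The slopes of [f], evaluated at the increment of [g], are multiplied by those of [g]; no
    remainder has to be estimated. *)
Lemma has_diff_comp n m (f : 'rV[R]_m -> R) (g : 'rV[R]_n -> 'rV[R]_m) x L (M : 'I_m -> 'I_n -> R) :
  has_diff f (g x) L -> (forall i, has_diff (fun y => g y ord0 i) x (M i)) ->
  has_diff (fun y => f (g y)) x (fun k => \sum_i L i * M i k).
Proof.
move=> [phi [hphi [d d0 hd]]] hg.
have hw i : continuous_at (fun h => (g (x + h) - g x) ord0 i) 0.
  apply: continuous_at_ext (continuous_at_add (has_diff_shift (hg i)) (continuous_at_const (- g x ord0 i) 0)) => h.
  by rewrite !mxE.
have [psi hpsi] := choice _ hg.
exists (fun k h => \sum_i phi i (g (x + h) - g x) * psi i k h); split.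
  move=> k; split.
    apply: continuous_at_sum => i; apply: continuous_at_mul; last by case: (hpsi i) => /(_ k) [].
    apply: (@continuous_at_comp R n m (phi i) (fun h => g (x + h) - g x)) => //.
    by rewrite addr0 subrr; case: (hphi i).
  apply: eq_bigr => i _; rewrite addr0 subrr.
  by have [_ ->] := hphi i; have [/(_ k) [_ ->] _] := hpsi i.
have [||d' d'0 hd'] := @common_radius R 'I_m (fun i d => forall h, nrm h < d ->
   g (x + h) ord0 i = g x ord0 i + \sum_k psi i k h * h ord0 k).
- by move=> i; case: (hpsi i).
- by move=> i a b h _ hab u hu; apply: h; apply: lt_le_trans hab.
have [d2 d20 hd2] := continuous_row_at hw d0.
exists (Num.min d' d2); first by rewrite lt_min d'0.
move=> h; rewrite lt_min => /andP [h1 h2].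
have := hd2 h; rewrite subr0 addr0 subrr subr0 => /(_ h2) /hd.
rewrite addrC subrK => ->; congr (_ + _).
rewrite (eq_bigr (fun i => \sum_k phi i (g (x + h) - g x) * psi i k h * h ord0 k)).
  by rewrite exchange_big; apply: eq_bigr => k _; rewrite mulr_suml.
move=> i _; rewrite [(g (x + h) - g x) ord0 i]mxE [(- g x) ord0 i]mxE hd' //.
rewrite addrC addKr mulr_sumr.
by apply: eq_bigr => k _; rewrite mulrA.
Qed.

End Differentials.

(** * Functions of class C^r and smoothness of inverses *)

Section Smoothness.
Variable R : realFieldType.

Definition ball_open n (U : 'rV[R]_n -> Prop) :=
  forall x, U x -> exists2 d, 0 < d & forall y, nrm (y - x) < d -> U y.

Lemma is_open_ball_open n (U : 'rV[R]_n -> Prop) : is_open U -> ball_open U.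
Proof.
move=> hU x /hU [lo [hi [_ [hx h]]]].
have [||d d0 hd] := @common_radius R 'I_n (fun i d => lo i < x ord0 i - d /\ x ord0 i + d < hi i).
- move=> i; have /andP [h1 h2] := hx i.
  exists (Num.min (x ord0 i - lo i) (hi i - x ord0 i) / 2).
    by rewrite divr_gt0 // lt_min; lra.
  have : Num.min (x ord0 i - lo i) (hi i - x ord0 i) <= x ord0 i - lo i by rewrite ge_min lexx.
  have : Num.min (x ord0 i - lo i) (hi i - x ord0 i) <= hi i - x ord0 i by rewrite ge_min lexx orbT.
  have : 0 < Num.min (x ord0 i - lo i) (hi i - x ord0 i) by rewrite lt_min; lra.
  by move: (Num.min _ _) => m; lra.
- by move=> i a b [h1 h2] h3 h4; lra.
exists d => // y hy; apply: h => i; have [h1 h2] := hd i.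
have := le_lt_trans (le_nrm _ i) hy; rewrite !mxE ltr_norml; lra.
Qed.

Lemma ball_open_ball n (x : 'rV[R]_n) d : ball_open (fun y => nrm (y - x) < d).
Proof.
move=> y hy; exists (d - nrm (y - x)); first by lra.
by move=> z hz; have := nrm_triangle z y x; lra.
Qed.

(** Scalar counterpart of [Cr]: each partial derivative is a function of its own, so induction on
    [r] stays within scalar functions. Continuity is taken in the whole space instead of relative to
    [U], which is the same for open [U]. *)
Fixpoint smooth (r n : nat) (U : 'rV[R]_n -> Prop) (f : 'rV[R]_n -> R) : Prop :=
  (forall x, U x -> continuous_at f x) /\
  if r is r'.+1 then
    exists D : 'I_n -> 'rV[R]_n -> R,
      (forall x, U x -> has_diff f x (fun k => D k x)) /\ forall k, smooth r' U (D k)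
  else True.

Lemma smooth_continuous r n (U : 'rV[R]_n -> Prop) f x : smooth r U f -> U x -> continuous_at f x.
Proof. by case: r => [|r] [h _]; apply: h. Qed.

Lemma smooth_sub r n (U V : 'rV[R]_n -> Prop) f :
  (forall x, V x -> U x) -> smooth r U f -> smooth r V f.
Proof.
move=> hVU; elim: r f => [|r IH] f [hc hD]; split=> //; try by move=> x /hVU /hc.
by case: hD => D [h1 h2]; exists D; split=> [x /hVU /h1 //|k]; apply: IH (h2 k).
Qed.

Lemma smooth_pred r n (U : 'rV[R]_n -> Prop) f : smooth r.+1 U f -> smooth r U f.
Proof.
elim: r f => [|r IH] f [hc [D [h1 h2]]]; split=> //.
by exists D; split=> // k; apply: IH.
Qed.

Lemma smooth_le r s n (U : 'rV[R]_n -> Prop) f : (r <= s)%N -> smooth s U f -> smooth r U f.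
Proof.
move=> /subnKC <-; elim: (s - r)%N => [|k IH]; first by rewrite addn0.
by rewrite addnS => /smooth_pred.
Qed.

Lemma smooth_ext r n (U : 'rV[R]_n -> Prop) f g : f =1 g -> smooth r U f -> smooth r U g.
Proof. by move=> h; have -> : g = f by apply: functional_extensionality => x; rewrite h. Qed.

(** Derivatives come from a different [g] near each point. One family is chosen for every [x], and
    the diagonal [DD x k x] is a global derivative; by uniqueness of differentials it agrees near
    [x] with the single smooth function [DD x k]. *)
Lemma smooth_local r n (U : 'rV[R]_n -> Prop) f : ball_open U ->
  (forall x, U x -> exists2 d, 0 < d & exists g,
     (forall y, nrm (y - x) < d -> g y = f y) /\ smooth r (fun y => nrm (y - x) < d) g) ->
  smooth r U f.
Proof.
elim: r f => [|r IH] f hU h.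
  split=> // x /h [d d0 [g [hg [hc _]]]]; apply: (continuous_at_local d0 hg); apply: hc.
  by rewrite subrr nrm0.
split.
  move=> x /h [d d0 [g [hg [hc _]]]]; apply: (continuous_at_local d0 hg); apply: hc.
  by rewrite subrr nrm0.
have h' x : exists D : 'I_n -> 'rV[R]_n -> R, U x -> exists2 d, 0 < d &
    (forall y, nrm (y - x) < d -> has_diff f y (fun k => D k y)) /\
    forall k, smooth r (fun y => nrm (y - x) < d) (D k).
  case: (classic (U x)) => hx; last by exists (fun _ _ => 0).
  have [d d0 [g [hg [_ [D [h1 h2]]]]]] := h x hx; exists D => _; exists d => //; split=> // y hy.
  have [d' d'0 hd'] := ball_open_ball hy.
  by apply: has_diff_local d'0 _ (h1 _ hy) => z /hd' /hg.
have [DD hDD] := choice _ h'.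
exists (fun k x => DD x k x); split.
  by move=> x /hDD [d d0 [h1 _]]; apply: h1; rewrite subrr nrm0.
move=> k; apply: IH => // x hx; have [d d0 [h1 h2]] := hDD x hx; have [d' d'0 hd'] := hU x hx.
exists (Num.min d d'); first by rewrite lt_min d0.
exists (DD x k); split; last by apply: smooth_sub (h2 k) => y; rewrite lt_min => /andP [].
move=> y; rewrite lt_min => /andP [hy /hd' Uy]; have [d2 d20 [h1' _]] := hDD y Uy.
by apply: (has_diff_unique (h1 y hy) (h1' y _)); rewrite subrr nrm0.
Qed.

Lemma smooth_const r n (U : 'rV[R]_n -> Prop) c : smooth r U (fun _ => c).
Proof.
elim: r c => [|r IH] c; split=> //; try by move=> x _; exact: continuous_at_const.
by exists (fun _ _ => 0); split=> [x _|k]; [apply: has_diff_const | apply: IH].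
Qed.

Lemma smooth_coord r n (U : 'rV[R]_n -> Prop) i : smooth r U (fun y => y ord0 i).
Proof.
case: r => [|r]; split=> //; try by move=> x _; exact: continuous_at_coord.
by exists (fun k _ => (k == i)%:R); split=> [x _|k]; [apply: has_diff_coord | apply: smooth_const].
Qed.

Lemma smooth_add r n (U : 'rV[R]_n -> Prop) f g : smooth r U f -> smooth r U g ->
  smooth r U (fun y => f y + g y).
Proof.
elim: r f g => [|r IH] f g [hf hf'] [hg hg']; split=> //;
  try by move=> x Ux; apply: continuous_at_add; [apply: hf | apply: hg].
case: hf' hg' => D [h1 h2] [E [h3 h4]]; exists (fun k x => D k x + E k x).
by split=> [x Ux|k]; [apply: has_diff_add; [apply: h1 | apply: h3] | apply: IH; [exact: h2 | exact: h4]].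
Qed.

Lemma smooth_mul r n (U : 'rV[R]_n -> Prop) f g : smooth r U f -> smooth r U g ->
  smooth r U (fun y => f y * g y).
Proof.
elim: r f g => [|r IH] f g hf hg.
  by split=> // x Ux; apply: continuous_at_mul; [case: hf => h _ | case: hg => h _]; apply: h.
have hf0 := smooth_pred hf; have hg0 := smooth_pred hg.
split; first by move=> x Ux; apply: continuous_at_mul; [case: hf => h _ | case: hg => h _]; apply: h.
case: hf hg => _ [D [h1 h2]] [_ [E [h3 h4]]].
exists (fun k x => D k x * g x + f x * E k x).
split=> [x Ux|k]; first by apply: has_diff_mul; [apply: h1 | apply: h3].
by apply: smooth_add; apply: IH => //; [exact: h2 | exact: h4].
Qed.

Lemma smooth_inv r n (U : 'rV[R]_n -> Prop) f : (forall x, U x -> f x != 0) ->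
  smooth r U f -> smooth r U (fun y => (f y)^-1).
Proof.
move=> f0; elim: r => [|r IH] hf.
  by split=> // x Ux; apply: continuous_at_inv; [apply: f0 | case: hf => h _; apply: h].
have hf0 := IH (smooth_pred hf).
split; first by move=> x Ux; apply: continuous_at_inv; [apply: f0 | case: hf => h _; apply: h].
case: hf => _ [D [h1 h2]].
exists (fun k x => - D k x * (f x)^-1 * (f x)^-1).
split=> [x Ux|k]; first by apply: has_diff_inv; [apply: f0 | apply: h1].
apply: smooth_mul => //; apply: smooth_mul => //.
move: (h2 k); rewrite -/smooth => {}h2.
by apply: smooth_ext (smooth_mul (smooth_const r U (-1)) h2) => x; rewrite mulN1r.
Qed.

Lemma smooth_sum r n (U : 'rV[R]_n -> Prop) (I : Type) (s : seq I) (F : I -> 'rV[R]_n -> R) :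
  (forall i, smooth r U (F i)) -> smooth r U (fun y => \sum_(i <- s) F i y).
Proof.
by apply: closed_sum; [move=> ? ?; apply: smooth_ext | move=> c; apply: smooth_const |
  move=> ? ?; apply: smooth_add].
Qed.

Lemma smooth_comp r n m (U : 'rV[R]_n -> Prop) (V : 'rV[R]_m -> Prop) f (g : 'rV[R]_n -> 'rV[R]_m) :
  (forall x, U x -> V (g x)) -> smooth r V f -> (forall i, smooth r U (fun y => g y ord0 i)) ->
  smooth r U (fun y => f (g y)).
Proof.
move=> hUV; elim: r f => [|r IH] f hf hg.
  split=> // x Ux; apply: continuous_at_comp; first by case: hf => h _; apply: h; apply: hUV.
  by move=> i; case: (hg i) => h _; apply: h.
have hg0 i := smooth_pred (hg i).
split.
  move=> x Ux; apply: continuous_at_comp; first by case: hf => h _; apply: h; apply: hUV.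
  by move=> i; case: (hg i) => h _; apply: h.
case: hf => _ [D [h1 h2]].
have hg' i : exists E : 'I_n -> 'rV[R]_n -> R,
    (forall x, U x -> has_diff (fun y => g y ord0 i) x (fun k => E k x)) /\ forall k, smooth r U (E k).
  by case: (hg i).
have [E hE] := choice _ hg'.
exists (fun k x => \sum_i D i (g x) * E i k x); split.
  move=> x Ux; apply: (has_diff_comp (L := fun i => D i (g x)) (M := fun i k => E i k x)).
    by apply: h1; apply: hUV.
  by move=> i; case: (hE i) => h _; apply: h.
move=> k; apply: smooth_sum => i; apply: smooth_mul; first by apply: IH => //; exact: h2.
by case: (hE i) => _; apply.
Qed.

Lemma mul_cramer d (A : 'M[R]_d) : \det A != 0 -> ((\det A)^-1 *: \adj A) *m A = 1%:M.
Proof. by move=> hA; rewrite -scalemxAl mul_adj_mx scale_scalar_mx mulVf. Qed.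

(** In slope form [q (g (u + h)) = u + h] reads [Phi h *m (w h)^T = h^T], where [w h] is the
    increment of [g] and [Phi 0 = J]. Inverting the continuous matrix [Phi h] by Cramer's rule
    exhibits continuous slopes of [g]. *)
Lemma has_diff_inverse d (q g : 'rV[R]_d -> 'rV[R]_d) u (J : 'M[R]_d) :
  (forall i, has_diff (fun s => q s ord0 i) (g u) (J i)) -> \det J != 0 ->
  (forall l, continuous_at (fun v => g v ord0 l) u) ->
  (exists2 e, 0 < e & forall v, nrm (v - u) < e -> q (g v) = v) ->
  forall l, has_diff (fun v => g v ord0 l) u (((\det J)^-1 *: \adj J) l).
Proof.
move=> hq hJ hg [e e0 he].
have [phi hphi] := choice _ hq.
pose w h := g (u + h) - g u.
have hw i : continuous_at (fun h => w h ord0 i) 0.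
  have hs : continuous_at (fun h => g (u + h) ord0 i) 0.
    apply: (@continuous_at_comp R d d (fun v => g v ord0 i) (fun h => u + h)); first by rewrite addr0.
    move=> j; apply: continuous_at_ext (continuous_at_add (continuous_at_const (u ord0 j) 0) (continuous_at_coord j 0)) => h.
    by rewrite mxE.
  apply: continuous_at_ext (continuous_at_add hs (continuous_at_const (- g u ord0 i) 0)) => h.
  by rewrite !mxE.
have w0 : w 0 = 0 by rewrite /w addr0 subrr.
pose Phi h : 'M[R]_d := \matrix_(i, k) phi i k (w h).
have Phi0 : Phi 0 = J.
  by apply/matrixP => i k; rewrite mxE w0; case: (hphi i) => /(_ k) [].
pose C f := continuous_at (R := R) (n := d) f 0.
have Cext f f' : f =1 f' -> C f -> C f' by exact: continuous_at_ext.
have Cconst c : C (fun _ => c) by exact: continuous_at_const.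
have Cadd f f' : C f -> C f' -> C (fun t => f t + f' t) by exact: continuous_at_add.
have Cmul f f' : C f -> C f' -> C (fun t => f t * f' t) by exact: continuous_at_mul.
have CPhi i k : C (fun h => Phi h i k).
  apply: Cext (fun h => esym (mxE _ _ i k)) _.
  apply: (@continuous_at_comp R d d (phi i k) w) => //.
  by rewrite w0; case: (hphi i) => /(_ k) [].
have Cdet : C (fun h => \det (Phi h)) by apply: closed_det.
have Cidet : C (fun h => (\det (Phi h))^-1) by apply: continuous_at_inv; rewrite ?Phi0.
have Ccr := closed_cramer Cext Cconst Cadd Cmul CPhi Cidet.
move=> l; exists (fun k h => ((\det (Phi h))^-1 *: \adj (Phi h)) l k).
split; first by move=> k; rewrite Phi0; split=> //; apply: Ccr.
have [|d1 d10 hd1] := Cdet `|\det J|; first by rewrite normr_gt0.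
have [||d2 d20 hd2] := @common_radius R 'I_d (fun i d' => forall h, nrm h < d' ->
   q (g u + h) ord0 i = q (g u) ord0 i + \sum_k phi i k h * h ord0 k).
- by move=> i; case: (hphi i).
- by move=> i a b h _ hab v hv; apply: h; apply: lt_le_trans hab.
have [d3 d30 hd3] := continuous_row_at hw d20.
exists (Num.min (Num.min d1 d3) e); first by rewrite !lt_min d10 d30.
move=> h; rewrite !lt_min => /andP [/andP [h1 h3] h2].
have hdet : \det (Phi h) != 0.
  apply/eqP => E; have := hd1 h; rewrite subr0 Phi0 E sub0r normrN ltxx => /(_ h1) //.
have hwh : nrm (w h) < d2 by have := hd3 h; rewrite subr0 w0 subr0; apply.
have gw : g (u + h) = g u + w h by rewrite /w [RHS]addrC subrK.
have E : Phi h *m (w h)^T = h^T.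
  apply/colP => i; rewrite !mxE.
  have := hd2 i (w h) hwh; rewrite -gw he ?he ?subrr ?nrm0 //; last by rewrite addrAC subrr add0r.
  rewrite mxE => /addrI ->; apply: eq_bigr => k _; by rewrite !mxE.
have := congr1 (mulmx ((\det (Phi h))^-1 *: \adj (Phi h))) E.
rewrite mulmxA mul_cramer // mul1mx => /colP /(_ l); rewrite mxE => Ew.
have -> : g (u + h) ord0 l = g u ord0 l + w h ord0 l by rewrite gw mxE.
by rewrite Ew mxE; congr (_ + _); apply: eq_bigr => k _; rewrite [h^T _ _]mxE.
Qed.

(** Bootstrapping: the differential of [g] is the inverse of that of [q], evaluated at [g]. If [g]
    is of class [C^k] with [k <= r], so is its differential, and [g] is of class [C^(k+1)]. *)
Lemma smooth_inverse r d (U V : 'rV[R]_d -> Prop) (q g : 'rV[R]_d -> 'rV[R]_d)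
    (D : 'I_d -> 'I_d -> 'rV[R]_d -> R) :
  ball_open U ->
  (forall i s, V s -> has_diff (fun s => q s ord0 i) s (fun k => D i k s)) ->
  (forall i k, smooth r V (D i k)) ->
  (forall s, V s -> \det (\matrix_(i, k) D i k s) != 0) ->
  (forall u, U u -> V (g u) /\ q (g u) = u) ->
  (forall l u, U u -> continuous_at (fun v => g v ord0 l) u) ->
  forall l, smooth r.+1 U (fun u => g u ord0 l).
Proof.
move=> hU hq hD hdet hg hgc.
suff h k : (k <= r.+1)%N -> forall l, smooth k U (fun u => g u ord0 l) by apply: h.
elim: k => [|k IH] hk l; first by split=> // u; apply: hgc.
split; first by move=> u; apply: hgc.
pose J s : 'M[R]_d := \matrix_(i, k) D i k s.
exists (fun k u => ((\det (J (g u)))^-1 *: \adj (J (g u))) l k); split.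
  move=> u Uu; have [Vg _] := hg u Uu.
  apply: (has_diff_inverse (q := q)).
  - move=> i; apply: has_diff_ext (hq i (g u) Vg) => // j; by rewrite mxE.
  - exact: hdet.
  - by move=> l'; apply: hgc.
  - have [e e0 he] := hU u Uu; exists e => // v /he /hg [] //.
have hJ i j : smooth k U (fun u => J (g u) i j).
  apply: smooth_ext (fun u => esym (mxE _ _ i j)) _.
  apply: (@smooth_comp k d d U V (D i j) g); first by move=> u /hg [].
    by apply: smooth_le (hD i j).
  by apply: IH; apply: ltnW.
have hext f f' : f =1 f' -> smooth k U f -> smooth k U f' by apply: smooth_ext.
have hconst c : smooth k U (fun _ => c) by apply: smooth_const.
have hadd f f' : smooth k U f -> smooth k U f' -> smooth k U (fun t => f t + f' t) by apply: smooth_add.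
have hmul f f' : smooth k U f -> smooth k U f' -> smooth k U (fun t => f t * f' t) by apply: smooth_mul.
move=> j; apply: (closed_cramer hext hconst hadd hmul hJ).
apply: smooth_inv; last exact: (closed_det hext hconst hadd hmul).
by move=> u /hg [/hdet].
Qed.

(** The index type [J] is arbitrary for the sake of the induction: the derivative of a [J]-indexed
    map is indexed by [J * 'I_n]. *)
Lemma Cr_smooth r n (J : Type) (U : 'rV[R]_n -> Prop) (f : 'rV[R]_n -> J -> R) :
  ball_open U -> Cr r U f -> forall j, smooth r U (fun x => f x j).
Proof.
move=> hU; elim: r J f => [|r IH] J f [hc hD] j.
all: have hc' x : U x -> continuous_at (fun x => f x j) x by
  (move=> Ux e e0; have [d [d0 hd]] := hc x Ux e e0; have [d' d'0 hd'] := hU x Ux;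
   exists (Num.min d d'); [by rewrite lt_min d0 |];
   move=> y; rewrite lt_min => /andP [h1 /hd' h2]; apply: hd => // k;
   by have := le_lt_trans (le_nrm _ k) h1; rewrite !mxE).
- by split.
split=> //; case: hD => D [h1 h2]; exists (fun k x => D x (j, k)); split.
  by move=> x Ux; apply: frechet_has_diff (h1 x Ux).
by move=> k; apply: IH h2 (j, k).
Qed.

Lemma smooth_Cr r n (J : finType) (U : 'rV[R]_n -> Prop) (f : 'rV[R]_n -> J -> R) :
  (forall j, smooth r U (fun x => f x j)) -> Cr r U f.
Proof.
elim: r J f => [|r IH] J f h.
all: have hc : cont_on U f by
  (move=> x Ux e e0;
   have [||d d0 hd] := @common_radius R J (fun j d => forall y, nrm (y - x) < d -> `|f y j - f x j| < e);
   [by move=> j; apply: (smooth_continuous (h j)) |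
    by move=> j a b h' _ hab v hv; apply: h'; apply: lt_le_trans hab |];
   exists d; split=> // y _ hy j; apply: hd; apply: nrm_lt => // k; rewrite !mxE).
- by split.
split=> //.
have h' j : exists D : 'I_n -> 'rV[R]_n -> R,
    (forall x, U x -> has_diff (fun x => f x j) x (fun k => D k x)) /\ forall k, smooth r U (D k).
  by case: (h j).
have [D hD] := choice _ h'; exists (fun x p => D p.1 p.2 x); split.
  by move=> x Ux; apply: has_diff_frechet => j; case: (hD j) => h1 _; apply: h1.
by apply: IH => -[j k] /=; case: (hD j).
Qed.

End Smoothness.

(** * Definable functions *)

Section DefinableFunctions.
Variables (R : realFieldType) (S : structure R).
Hypothesis hS : is_structure S.

Definition dfun n (f : 'rV[R]_n -> R) := dterm S (fun e => f (\row_i e i)).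

Lemma dterm_fun n (f : 'rV[R]_n -> R) (v : (nat -> R) -> 'rV[R]_n) :
  dfun f -> (forall i, dterm S (fun e => v e ord0 i)) -> dterm S (fun e => f (v e)).
Proof.
move=> hf hv.
pose T k e := if insub k is Some i then v e ord0 i else 0.
have hT k : dterm S (T k).
  by rewrite /T; case: insubP => [i _ _|_] //; apply: (dterm_const hS).
apply: dterm_ext (dterm_subst hS hf hT) => e.
by congr f; apply/rowP => i; rewrite mxE /T valK.
Qed.

Lemma dterm_nrm n (v : (nat -> R) -> 'rV[R]_n) :
  (forall i, dterm S (fun e => v e ord0 i)) -> dterm S (fun e => nrm (v e)).
Proof.
move=> hv; rewrite /nrm; elim: (index_enum _) => [|i s IH].
  by apply: dterm_ext (dterm_const hS 0) => e; rewrite big_nil.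
apply: (@dterm_ext _ _ (fun e => (`|v e ord0 i| + \big[Num.max/0]_(i <- s) `|v e ord0 i| +
    `| `|v e ord0 i| - \big[Num.max/0]_(i <- s) `|v e ord0 i| |) / 2)).
  by move=> e; rewrite big_cons maxr_absE.
by repeat first [exact: IH | exact: hv | definable_step hS].
Qed.

Lemma dterm_rowD n (v w : (nat -> R) -> 'rV[R]_n) i :
  dterm S (fun e => v e ord0 i) -> dterm S (fun e => w e ord0 i) ->
  dterm S (fun e => (v e + w e) ord0 i).
Proof. by move=> hv hw; apply: dterm_ext (dterm_add hS hv hw) => e; rewrite mxE. Qed.

Lemma dterm_rowN n (v : (nat -> R) -> 'rV[R]_n) i :
  dterm S (fun e => v e ord0 i) -> dterm S (fun e => (- v e) ord0 i).
Proof. by move=> hv; apply: dterm_ext (dterm_opp hS hv) => e; rewrite mxE. Qed.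

Lemma dterm_rowZ n (v : (nat -> R) -> 'rV[R]_n) t i :
  dterm S t -> dterm S (fun e => v e ord0 i) -> dterm S (fun e => (t e *: v e) ord0 i).
Proof. by move=> ht hv; apply: dterm_ext (dterm_mul hS ht hv) => e; rewrite mxE. Qed.

Lemma dterm_rowM n m (v : (nat -> R) -> 'rV[R]_n) (B : 'M[R]_(n, m)) i :
  (forall j, dterm S (fun e => v e ord0 j)) -> dterm S (fun e => (v e *m B) ord0 i).
Proof.
move=> hv; apply: (@dterm_ext _ _ (fun e => \sum_j v e ord0 j * B j i)) => [e|]; first by rewrite mxE.
by repeat first [exact: hv | definable_step hS].
Qed.

Lemma dterm_coord_proj n m (v : (nat -> R) -> 'rV[R]_n) (sigma : 'I_m -> 'I_n) i :
  (forall j, dterm S (fun e => v e ord0 j)) -> dterm S (fun e => coord_proj sigma (v e) ord0 i).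
Proof. by move=> hv; apply: dterm_ext (hv (sigma i)) => e; rewrite mxE. Qed.

End DefinableFunctions.

Ltac definable_row_step hS :=
  cbv beta; first
  [ apply: (dterm_nrm hS) => ? | apply: (dterm_rowD hS) | apply: (dterm_rowN hS)
  | apply: (dterm_rowZ hS) | apply: (dterm_rowM hS) => ? | apply: dterm_coord_proj => ?
  | definable_step hS ].

(** * Mean value inequality and inverse function theorem *)

Section InverseFunction.
Variables (R : realFieldType) (S : structure R).
Hypotheses (hS : is_structure S) (hdc : definably_complete S).

Lemma has_diff_bound n (f : 'rV[R]_n -> R) x L c e : has_diff f x L -> \sum_k `|L k| <= c -> 0 < e ->
  exists2 d, 0 < d & forall h, nrm h < d -> `|f (x + h) - f x| <= (c + e) * nrm h.
Proof.
move=> [phi [hphi [d d0 hd]]] hc e0.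
pose F h := \sum_k `|phi k h|.
have [d' d'0 hd'] : exists2 d', 0 < d' & forall h, nrm h < d' -> F h <= c + e.
  (* The [n] errors then add up to less than [e]; the [+ 1] keeps the denominator positive when
     [n = 0]. *)
  pose e' := e / (n%:R + 1).
  have n0 : 0 < n%:R + 1 :> R by rewrite ltr_wpDl.
  have e'0 : 0 < e' by rewrite divr_gt0.
  have [||d' d'0 hd'] := @common_radius R 'I_n (fun k d => forall h, nrm h < d -> `|phi k h| <= `|L k| + e').
  - move=> k; have [hk hk0] := hphi k; have [d' d'0 hd'] := hk e' e'0.
    exists d' => // h hh; have := hd' h; rewrite subr0 hk0 => /(_ hh) A.
    by have := ler_normD (L k) (phi k h - L k); rewrite addrC subrK; lra.
  - by move=> k a b h _ hab v hv; apply: h; apply: lt_le_trans hab.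
  exists d' => // h hh; apply: (@le_trans _ _ (\sum_k (`|L k| + e'))).
    by apply: ler_sum => k _; apply: hd'.
  rewrite big_split /= sumr_const card_ord lerD // -mulr_natl /e' mulrA ler_pdivrMr //.
  by rewrite mulrDr mulr1 mulrC lerDl ltW.
exists (Num.min d d'); first by rewrite lt_min d0.
move=> h; rewrite lt_min => /andP [/hd -> /hd' h2].
rewrite addrC addKr; apply: le_trans (ler_norm_sum _ _ _) _.
apply: le_trans (_ : F h * nrm h <= _); last by rewrite ler_wpM2r // nrm_ge0.
by rewrite mulr_suml; apply: ler_sum => k _; rewrite normrM ler_wpM2l // le_nrm.
Qed.

Lemma mean_value n (f : 'rV[R]_n -> R) (D : 'I_n -> 'rV[R]_n -> R) rho c s t :
  dfun S f -> (forall y, nrm y <= rho -> has_diff f y (fun k => D k y)) ->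
  (forall y, nrm y <= rho -> \sum_k `|D k y| <= c) ->
  nrm s <= rho -> nrm t <= rho -> `|f t - f s| <= c * nrm (t - s).
Proof.
move=> hf hD hc hs ht; set v := t - s; set N := nrm v.
have N0 : 0 <= N by apply: nrm_ge0.
apply/ler_addgt0Pr => e' e'0.
have N1 : 0 < N + 1 by lra.
pose e := e' / (N + 1); have e0 : 0 < e by rewrite divr_gt0.
have heN : e * N <= e'.
  have : e * (N + 1) = e' by rewrite divfK // gt_eqF.
  by rewrite mulrDr mulr1; lra.
apply: (@le_trans _ _ ((c + e) * N)); last by rewrite mulrDl lerD2l.
have c0 : 0 <= c by apply: le_trans (hc s hs); apply: sumr_ge0.
suff : `|f (s + 1 *: v) - f s| <= (c + e) * N * 1 by rewrite scale1r mulr1 [s + v]addrC subrK.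
have := @definable_induction _ _ hS hdc (fun u => `|f (s + u *: v) - f s| <= (c + e) * N * u) 0 1; apply=> //.
- by repeat first [apply: (dterm_fun hS hf) | definable_row_step hS].
- by rewrite scale0r addr0 subrr normr0 mulr0.
move=> u u0 u1.
have hu : nrm (s + u *: v) <= rho.
  have -> : s + u *: v = (1 - u) *: s + u *: t.
    by rewrite /v scalerBr scalerBl scale1r addrCA addrA [RHS]addrC addrA.
  apply: le_trans (nrmD _ _) _; apply: le_trans (lerD (nrmZ _ _) (nrmZ _ _)) _.
  rewrite !ger0_norm //; last by lra.
  have A : (1 - u) * nrm s <= (1 - u) * rho by rewrite ler_wpM2l //; lra.
  have B : u * nrm t <= u * rho by rewrite ler_wpM2l.
  by lra.
have [d d0 hd] := has_diff_bound (hD _ hu) (hc _ hu) e0.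
exists (d / (N + 1)); first by rewrite divr_gt0.
have hz z : `|z - u| < d / (N + 1) -> `|f (s + z *: v) - f (s + u *: v)| <= (c + e) * N * `|z - u|.
  move=> hz; have -> : s + z *: v = (s + u *: v) + (z - u) *: v.
    by rewrite -addrA -scalerDl addrC [u + _]addrC subrK addrC.
  have hle : nrm ((z - u) *: v) <= N * `|z - u| by rewrite mulrC; apply: nrmZ.
  apply: le_trans (hd _ _) _.
    apply: le_lt_trans hle _; move: hz; rewrite ltr_pdivlMr //.
    by apply: le_lt_trans; rewrite mulrC ler_wpM2l //; lra.
  by rewrite -mulrA ler_wpM2l //; lra.
move=> x y x0 y1 h1 h2 h3 h4 hx.
have Ex : `|x - u| = u - x by rewrite ler0_norm; lra.
have Ey : `|y - u| = y - u by rewrite ger0_norm; lra.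
have := hz x; rewrite Ex => /(_ ltac:(lra)) Hx.
have := hz y; rewrite Ey => /(_ ltac:(lra)) Hy.
have -> : f (s + y *: v) - f s = (f (s + y *: v) - f (s + u *: v)) +
  ((f (s + u *: v) - f (s + x *: v)) + (f (s + x *: v) - f s)) by ring.
apply: le_trans (ler_normD _ _) _; apply: le_trans (lerD (lexx _) (ler_normD _ _)) _.
rewrite [`|f (s + u *: v) - _|]distrC.
have -> : (c + e) * N * y = (c + e) * N * (y - u) + ((c + e) * N * (u - x) + (c + e) * N * x) by ring.
by apply: lerD => //; apply: lerD.
Qed.

(** The sum of the [|D k y|] is the operator norm dual to [nrm]; being less than [c] at 0, it is at
    most [c] nearby by continuity, and [mean_value] applies. *)
Lemma locally_lipschitz n (f : 'rV[R]_n -> R) (D : 'I_n -> 'rV[R]_n -> R) delta c :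
  0 < delta -> dfun S f -> (forall y, nrm y < delta -> has_diff f y (fun k => D k y)) ->
  (forall k, continuous_at (D k) 0) -> \sum_k `|D k 0| < c ->
  exists2 rho, 0 < rho & forall rho', rho' <= rho ->
    forall s t, nrm s <= rho' -> nrm t <= rho' -> `|f s - f t| <= c * nrm (s - t).
Proof.
move=> delta0 hf hD hc hlt.
pose e := (c - \sum_k `|D k 0|) / (n%:R + 1).
have n0 : 0 < n%:R + 1 :> R by rewrite ltr_wpDl.
have e0 : 0 < e by rewrite divr_gt0 // subr_gt0.
have [||d d0 hd] := @common_radius R 'I_n (fun k d => forall h, nrm h < d -> `|D k h| <= `|D k 0| + e).
- move=> k; have [d d0 hd] := hc k e e0.
  exists d => // h hh; have := hd h; rewrite subr0 => /(_ hh) A.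
  by have := ler_normD (D k 0) (D k h - D k 0); rewrite addrC subrK; lra.
- by move=> k a b h _ hab v hv; apply: h; apply: lt_le_trans hab.
have m0 : 0 < Num.min d delta by rewrite lt_min d0.
have [md mD] : Num.min d delta <= d /\ Num.min d delta <= delta by rewrite !ge_min !lexx orbT.
exists (Num.min d delta / 2); first by lra.
move=> rho hrho s t hs ht; apply: (mean_value (D := D) (rho := rho)) => // y hy.
  by apply: hD; lra.
apply: (@le_trans _ _ (\sum_k (`|D k 0| + e))).
  by apply: ler_sum => k _; apply: hd; lra.
rewrite big_split /= sumr_const card_ord -mulr_natl.
have : e * (n%:R + 1) = c - \sum_k `|D k 0| by rewrite divfK // gt_eqF.
by rewrite mulrDr mulr1 [n%:R * e]mulrC; lra.
Qed.

(* The approximate solutions [K e] of [q s = u] are nonempty and have diameter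
   at most [4 * e]; definable suprema of their coordinates replace the limit of
   the usual fixed point iteration. *)
Lemma near_identity_onto d (q : 'rV[R]_d -> 'rV[R]_d) rho :
  (forall j, dfun S (fun s => q s ord0 j)) -> 0 < rho -> q 0 = 0 ->
  (forall s t, nrm s <= rho -> nrm t <= rho -> nrm (q s - q t - (s - t)) <= nrm (s - t) / 2) ->
  forall u, nrm u <= rho / 2 -> exists2 s, nrm s <= rho & q s = u.
Proof.
move=> hq rho0 q0 hnear u hu.
have hqd (v : (nat -> R) -> 'rV[R]_d) j : (forall i, dterm S (fun e => v e ord0 i)) ->
    dterm S (fun e => q (v e) ord0 j) by exact: (dterm_fun hS (hq j)).
have hlow s t : nrm s <= rho -> nrm t <= rho -> nrm (s - t) <= 2 * nrm (q s - q t).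
  move=> hs ht; have := hnear s t hs ht.
  have := nrmD (- (q s - q t - (s - t))) (q s - q t).
  by rewrite nrmN opprB subrK; lra.
pose K e s := nrm s <= rho /\ nrm (q s - u) <= e.
have K0 e : 0 < e -> exists s, K e s.
  (* The infimum [m] of the residual [nrm (q s - u)], obtained as the supremum of its lower
     bounds. *)
  have [] := @definable_sup _ _ hS hdc (fun t => forall s, nrm s <= rho -> t <= nrm (q s - u)).
  - by repeat first [apply: hqd => ? | definable_row_step hS].
  - by exists 0 => s _; apply: nrm_ge0.
  - by exists (nrm (q 0 - u)) => t; apply; rewrite nrm0 ltW.
  move=> m [h1 h2] e0; apply: NNPP => hno.
  have hm s : nrm s <= rho -> m <= nrm (q s - u) by move=> hs; apply: h2 => t; apply.
  have em : e <= m.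
    by apply: h1 => s hs; rewrite leNgt; apply/negP => hlt; apply: hno; exists s; split=> //; apply: ltW.
  (* The fixed point step [s' = s - q s + u] at least halves the residual, bringing it below
     [3 / 4 * m], against the choice of [m]. It stays in the ball of radius [rho] because
     [nrm u <= rho / 2]. *)
  have [s hs hsm] : exists2 s, nrm s <= rho & nrm (q s - u) < 3 / 2 * m.
    apply: NNPP => hno'; suff : 3 / 2 * m <= m by lra.
    apply: h1 => s hs; rewrite leNgt; apply/negP => hlt; apply: hno'; by exists s.
  pose s' := s - q s + u.
  have hs' : nrm s' <= rho.
    have := hnear s 0 hs; rewrite nrm0 q0 !subr0 => /(_ (ltW rho0)).
    have := nrmD (s - q s) u; rewrite -/s' [nrm (s - q s)]nrmB; lra.
  have E : s' - s = u - q s by rewrite /s' addrC addrA addKr addrC.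
  have := hnear s' s hs' hs; have := hm s' hs'; rewrite E [nrm (u - q s)]nrmB.
  by rewrite opprB addrA subrK; lra.
have Kd e s t : K e s -> K e t -> nrm (s - t) <= 4 * e.
  move=> [hs hs'] [ht ht']; have := hlow s t hs ht.
  by have := nrm_triangle (q s) u (q t); rewrite [nrm (u - q t)]nrmB; lra.
have hx i : exists x, - rho <= x /\ x <= rho /\ forall e s, 0 < e -> K e s -> `|x - s ord0 i| <= 4 * e.
  (* Coordinate [i] of the solution is the supremum of the numbers that are lower bounds on some
     [K e]; by [Kd] it is within [4 * e] of the coordinate of any point of [K e]. *)
  have [] := @definable_sup _ _ hS hdc (fun t => exists e, 0 < e /\ forall s, K e s -> t <= s ord0 i).
  - by rewrite /K; repeat first [apply: hqd => ? | definable_row_step hS].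
  - exists (- rho), 1; split=> // s [hs _]; have := le_trans (le_nrm s i) hs.
    by rewrite ler_norml => /andP [].
  - exists rho => t [e [e0 he]]; have [s Ks] := K0 e e0; have [hs _] := Ks.
    by have := le_trans (le_nrm s i) hs; rewrite ler_norml; have := he s Ks; lra.
  move=> x [h1 h2]; exists x; split; last split.
  - apply: h1; exists 1; split=> // s [hs _]; have := le_trans (le_nrm s i) hs.
    by rewrite ler_norml => /andP [].
  - apply: h2 => t [e [e0 he]]; have [s Ks] := K0 e e0; have [hs _] := Ks.
    by have := le_trans (le_nrm s i) hs; rewrite ler_norml; have := he s Ks; lra.
  move=> e s e0 Ks; rewrite ler_norml; apply/andP; split.
    suff : s ord0 i - 4 * e <= x by lra.
    apply: h1; exists e; split=> // t Kt.
    by have := le_trans (le_nrm _ i) (Kd e s t Ks Kt); rewrite !mxE ler_norml; lra.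
  suff : x <= s ord0 i + 4 * e by lra.
  apply: h2 => t [e' [e'0 he']].
  have m0 : 0 < Num.min e e' by rewrite lt_min e0.
  have [s' [hs1 hs2]] := K0 _ m0.
  have Ks' : K e s' by split=> //; apply: le_trans hs2 _; rewrite ge_min lexx.
  have Ks'' : K e' s' by split=> //; apply: le_trans hs2 _; rewrite ge_min lexx orbT.
  have := le_trans (le_nrm _ i) (Kd e s' s Ks' Ks); rewrite !mxE ler_norml.
  by have := he' s' Ks''; lra.
have [x {}hx] := choice _ hx.
pose X : 'rV[R]_d := \row_i x i.
have hX : nrm X <= rho.
  by apply: nrm_le => [|i]; rewrite ?(ltW rho0) // mxE ler_norml; have [? [? _]] := hx i; lra.
exists X => //; apply/eqP; rewrite -subr_eq0; apply/eqP/nrm_eq0.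
rewrite leNgt; apply/negP => hpos.
(* A point [s] of [K (c / 8)] is within [c / 2] of [X], so [nrm (q X - q s) <= 3 / 4 * c] and the
   residual [c] of [X] would be at most [7 / 8 * c]. *)
set c := nrm _ in hpos; have e0 : 0 < c / 8 by lra.
have [s Ks] := K0 _ e0; have [hs hsu] := Ks.
have hXs : nrm (X - s) <= 4 * (c / 8).
  by apply: nrm_le => [|i]; first lra; rewrite !mxE; have [_ [_ h]] := hx i; apply: h.
have := hnear X s hX hs.
have := nrm_triangle (q X) (q s) u; rewrite -/c.
have := nrmD (q X - q s - (X - s)) (X - s); rewrite subrK; lra.
Qed.

(** The differential of [q] minus the identity vanishes at 0, so this difference has Lipschitz
    constant [1 / 2] near 0. *)
Lemma near_identity d (q : 'rV[R]_d -> 'rV[R]_d) (D : 'I_d -> 'I_d -> 'rV[R]_d -> R) delta :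
  0 < delta -> (forall j, dfun S (fun s => q s ord0 j)) ->
  (forall i s, nrm s < delta -> has_diff (fun s => q s ord0 i) s (fun k => D i k s)) ->
  (forall i k, continuous_at (D i k) 0) -> (forall i k, D i k 0 = (k == i)%:R) ->
  exists2 rho, 0 < rho & forall rho', rho' <= rho -> forall s t, nrm s <= rho' -> nrm t <= rho' ->
    nrm (q s - q t - (s - t)) <= nrm (s - t) / 2.
Proof.
move=> delta0 hq hD hDc hD0.
have [||rho rho0 hrho] := @common_radius R 'I_d (fun i d => forall s t, nrm s <= d -> nrm t <= d ->
    `|(q s ord0 i - s ord0 i) - (q t ord0 i - t ord0 i)| <= 1 / 2 * nrm (s - t)).
- move=> i; have [||||rho rho0 hrho] := @locally_lipschitz d (fun s => q s ord0 i - s ord0 i)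
    (fun k s => D i k s + (- (k == i)%:R)) delta (1 / 2) delta0.
  + by repeat first [apply: (hq i) | definable_step hS].
  + move=> y hy; apply: has_diff_add; first exact: hD.
    have := has_diff_mul (has_diff_const (-1) y) (has_diff_coord i y).
    by apply: has_diff_ext => z; rewrite /= ?mulN1r // mul0r add0r.
  + by move=> k; apply: continuous_at_add => //; apply: continuous_at_const.
  + by rewrite big1 => [|k _]; [lra | rewrite hD0 subrr normr0].
  by exists rho => // s t; apply: hrho.
- by move=> i a b h _ hba s t hs ht; apply: h; lra.
exists rho => // rho' hr' s t hs ht; apply: nrm_le => [|i]; first by rewrite divr_ge0 ?nrm_ge0.
have := hrho i s t (le_trans hs hr') (le_trans ht hr'); rewrite !mxE.
have -> : q s ord0 i - q t ord0 i - (s ord0 i - t ord0 i) =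
   (q s ord0 i - s ord0 i) - (q t ord0 i - t ord0 i) by ring.
by move=> h; lra.
Qed.

(** Near 0 the map [q] shrinks distances at most by half, so the chosen preimages depend
    continuously on [u]. The determinant stays within distance 1 of its value 1 at the origin, hence
    is nonzero, and [smooth_inverse] applies. *)
Lemma local_inverse r d (q : 'rV[R]_d -> 'rV[R]_d) (D : 'I_d -> 'I_d -> 'rV[R]_d -> R) delta :
  0 < delta -> (forall j, dfun S (fun s => q s ord0 j)) -> q 0 = 0 ->
  (forall i s, nrm s < delta -> has_diff (fun s => q s ord0 i) s (fun k => D i k s)) ->
  (forall i k, smooth r (fun s => nrm s < delta) (D i k)) -> (forall i k, D i k 0 = (k == i)%:R) ->
  exists2 e, 0 < e & exists g : 'rV[R]_d -> 'rV[R]_d,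
    (forall u, nrm u < e -> nrm (g u) <= 2 * nrm u /\ q (g u) = u) /\
    forall l, smooth r.+1 (fun u => nrm u < e) (fun u => g u ord0 l).
Proof.
move=> delta0 hq q0 hD hDs hD0.
have hDc i k : continuous_at (D i k) 0 by apply: smooth_continuous (hDs i k) _; rewrite nrm0.
have [rho1 rho10 hnear] := near_identity delta0 hq hD hDc hD0.
have hdet : continuous_at (fun s => \det (\matrix_(i, k) D i k s)) 0.
  apply: (@closed_det R _ (fun f => @continuous_at R d f 0)).
  - by move=> f f'; apply: continuous_at_ext.
  - by move=> c; apply: continuous_at_const.
  - by move=> f f'; apply: continuous_at_add.
  - by move=> f f'; apply: continuous_at_mul.
  by move=> i k; apply: continuous_at_ext (hDc i k) => s; rewrite mxE.
have det0 : \det (\matrix_(i, k) D i k 0) = 1.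
  rewrite -(det1 R d); congr (\det _); apply/matrixP => i k.
  by rewrite !mxE hD0 eq_sym.
have [|d1 d10 hd1] := hdet 1; first exact: ltr01.
pose rho := Num.min (Num.min rho1 d1) delta / 2.
have [rho0 [r1 [r2 r3]]] : 0 < rho /\ rho <= rho1 /\ rho < d1 /\ rho < delta.
  have : 0 < Num.min (Num.min rho1 d1) delta by rewrite !lt_min rho10 d10.
  have : Num.min (Num.min rho1 d1) delta <= rho1 by rewrite !ge_min lexx.
  have : Num.min (Num.min rho1 d1) delta <= d1 by rewrite !ge_min lexx orbT.
  have : Num.min (Num.min rho1 d1) delta <= delta by rewrite !ge_min lexx orbT.
  by rewrite /rho; move: (Num.min _ _) => m; lra.
have {}hnear := hnear rho r1.
have honto := near_identity_onto hq rho0 q0 hnear.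
have hlow s t : nrm s <= rho -> nrm t <= rho -> nrm (s - t) <= 2 * nrm (q s - q t).
  move=> hs ht; have := hnear s t hs ht.
  have := nrmD (- (q s - q t - (s - t))) (q s - q t).
  by rewrite nrmN opprB subrK; lra.
have hg u : exists s, nrm u < rho / 2 -> nrm s <= rho /\ q s = u.
  case: (ltP (nrm u) (rho / 2)) => hu; last by exists 0.
  by have [s hs hsu] := honto u (ltW hu); exists s.
have [g {}hg] := choice _ hg.
have hg2 u : nrm u < rho / 2 -> nrm (g u) <= 2 * nrm u /\ q (g u) = u.
  move=> hu; have [h1 h2] := hg u hu; split=> //.
  by have := hlow _ 0 h1; rewrite nrm0 q0 h2 !subr0 => /(_ (ltW rho0)).
have hdr : 0 < rho / 2 by lra.
have hop : ball_open (fun u : 'rV[R]_d => nrm u < rho / 2).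
  move=> x hx; exists (rho / 2 - nrm x); first by lra.
  by move=> y hy; have := nrmD (y - x) x; rewrite subrK; lra.
exists (rho / 2) => //; exists g; split=> //.
apply: (smooth_inverse (V := fun s => nrm s < rho) (q := q) (D := D)) => //.
- by move=> i s hs; apply: hD; lra.
- by move=> i k; apply: smooth_sub (hDs i k) => s hs; lra.
- move=> s hs; apply/eqP => E; have := hd1 s; rewrite subr0 det0 E sub0r normrN normr1 ltxx.
  by move=> /(_ ltac:(lra)).
- by move=> u hu; have [h1 h2] := hg2 u hu; split=> //; lra.
move=> l u hu e e0; have [d' d'0 hd'] := hop u hu.
exists (Num.min d' (e / 2)); first by rewrite lt_min d'0; lra.
move=> v; rewrite lt_min => /andP [/hd' hv hve].
have [h1 h2] := hg u hu; have [h1' h2'] := hg v hv.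
have := hlow _ _ h1' h1; rewrite h2 h2' => h.
by have := le_nrm (g v - g u) l; rewrite !mxE; lra.
Qed.

End InverseFunction.

(** * Local parametrizations and sections of the coordinate projections *)

Section LocalSections.
Variables (R : realFieldType) (S : structure R).
Hypotheses (hS : is_structure S) (hdc : definably_complete S).

Lemma dterm_coords n (v : (nat -> R) -> 'rV[R]_n) k :
  (forall i, dterm S (fun e => v e ord0 i)) -> dterm S (fun e => coords (v e) k).
Proof.
by move=> hv; rewrite /coords; case: insubP => [i _ _|_]; [apply: hv | apply: (dterm_const hS)].
Qed.

Lemma dterm_row_mx n m (v : (nat -> R) -> 'rV[R]_n) (w : (nat -> R) -> 'rV[R]_m) i :
  (forall j, dterm S (fun e => v e ord0 j)) -> (forall j, dterm S (fun e => w e ord0 j)) ->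
  dterm S (fun e => row_mx (v e) (w e) ord0 i).
Proof.
move=> hv hw; case: (split_ordP i) => j ->.
  by apply: dterm_ext (hv j) => e; rewrite row_mxEl.
by apply: dterm_ext (hw j) => e; rewrite row_mxEr.
Qed.

Lemma dpred_eq_row n (v w : (nat -> R) -> 'rV[R]_n) :
  (forall i, dterm S (fun e => v e ord0 i)) -> (forall i, dterm S (fun e => w e ord0 i)) ->
  dpred S (fun e => v e = w e).
Proof.
move=> hv hw; apply: (@dpred_iff _ _ (fun e => forall i, v e ord0 i = w e ord0 i)).
  by move=> e; split=> [/rowP|-> //].
by apply: (dpred_forall_ord hS) => i; apply: (dpred_eq hS).
Qed.

(** [def_map] controls a map only on its domain. Setting it to 0 elsewhere turns it into a total
    definable function, which can occur in terms. *)
Definition extend0 n m (U : 'rV[R]_n -> Prop) (f : 'rV[R]_n -> 'rV[R]_m) x :=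
  if excluded_middle_informative (U x) then f x else 0.

Lemma extend0E n m (U : 'rV[R]_n -> Prop) (f : 'rV[R]_n -> 'rV[R]_m) x : U x -> extend0 U f x = f x.
Proof. by rewrite /extend0; case: excluded_middle_informative. Qed.

Lemma dfun_extend0 n m (U : 'rV[R]_n -> Prop) (f : 'rV[R]_n -> 'rV[R]_m) j :
  S U -> def_map S U f -> dfun S (fun x => extend0 U f x ord0 j).
Proof.
move=> hU hf; apply: dterm_graph.
apply: (@dpred_iff _ _ (fun e => exists w : 'rV[R]_m,
  ((U (lsubmx (row_mx (\row_i e i.+1) w)) /\
    f (lsubmx (row_mx (\row_i e i.+1) w)) = rsubmx (row_mx (\row_(i < n) e i.+1) w)) \/
   (~ U (\row_i e i.+1) /\ w = 0)) /\ e 0%N = w ord0 j)) => [e|].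
  set x : 'rV[R]_n := \row_i e i.+1; split=> [[w]|].
    rewrite row_mxKl row_mxKr => -[[[Ux <-]|[nU ->]] ->]; first by rewrite extend0E.
    by rewrite /extend0; case: excluded_middle_informative.
  move=> h; exists (extend0 U f x); split=> //; rewrite row_mxKl row_mxKr.
  by rewrite /extend0; case: excluded_middle_informative => Ux; [left | right].
apply: (dpred_exists_row hS); apply: (dpred_and hS); last by definable hS.
apply: (dpred_or hS).
  apply: (dpred_structure hS hf) => i; apply: dterm_row_mx => k; definable hS.
apply: (dpred_and hS).
  by apply: (dpred_not hS); apply: (dpred_structure hS hU); definable hS.
by apply: dpred_eq_row => i; [definable hS | apply: dterm_ext (dterm_const hS 0) => e; rewrite mxE].
Qed.

(** All that is kept of a chart. [param_onto] stands for continuity at [a] of the inverse of [p],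
    and [param_inj] for full rank of the differential at 0, in row-vector convention. The
    derivatives [D] are of class [C^r], so [p] is of class [C^(r+1)]. *)
Record parametrization r n d (X : 'rV[R]_n -> Prop) (a : 'rV[R]_n)
    (p : 'rV[R]_d -> 'rV[R]_n) (D : 'I_n -> 'I_d -> 'rV[R]_d -> R) (delta : R) : Prop := {
  param_gt0 : 0 < delta;
  param_dfun : forall i, dfun S (fun s => p s ord0 i);
  param0 : p 0 = a;
  param_in : forall s, nrm s < delta -> X (p s);
  param_diff : forall i s, nrm s < delta -> has_diff (fun s => p s ord0 i) s (fun k => D i k s);
  param_smooth : forall i k, smooth r (fun s => nrm s < delta) (D i k);
  param_onto : forall rho, 0 < rho -> exists2 eta, 0 < eta &
    forall x, X x -> nrm (x - a) < eta -> exists2 s, nrm s < rho & p s = x;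
  param_inj : forall v : 'rV[R]_d, v *m (\matrix_(k, i) D i k 0) = 0 -> v = 0 }.

Lemma submanifold_param r n d (X : 'rV[R]_n -> Prop) a :
  Dr_submanifold_dim S r.+1 d X -> X a ->
  exists p D delta, parametrization r (d := d) X a p D delta.
Proof.
move=> [hX [hdn h]] Xa; have {h} [U [V [phi [hU [oU [Ua [hV [oV [V0 [hdiff [phia hchart]]]]]]]]]]] := h a Xa.
have [psi [[_ phiC] [[psid psiC] [hUV hVU]]]] := hdiff.
have {}oU := is_open_ball_open oU; have {}oV := is_open_ball_open oV.
have phis := Cr_smooth oU phiC; have psis := Cr_smooth oV psiC.
pose pad (s : 'rV[R]_d) : 'rV[R]_n := \row_i coords s i.
have pad0 : pad 0 = 0.
  by apply/rowP => i; rewrite !mxE /coords; case: insubP => [j _ _|_] //; rewrite mxE.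
have pad_nrm s : nrm (pad s) <= nrm s.
  apply: nrm_le => [|i]; first exact: nrm_ge0.
  rewrite mxE /coords; case: insubP => [j _ _|_]; first exact: le_nrm.
  by rewrite normr0 nrm_ge0.
have [delta delta0 hdelta] : exists2 delta, 0 < delta & forall s, nrm s < delta -> V (pad s).
  have [e e0 he] := oV 0 V0; exists e => // s hs; apply: he.
  by rewrite subr0; apply: le_lt_trans (pad_nrm s) hs.
have pads i : smooth r.+1 (fun s => nrm s < delta) (fun s => pad s ord0 i).
  apply: smooth_ext (fun s => esym (mxE _ _ ord0 i)) _; rewrite /coords.
  by case: insubP => [j _ _|_]; [apply: smooth_coord | apply: smooth_const].
pose p s := extend0 V psi (pad s).
have pE s : nrm s < delta -> p s = psi (pad s) by move=> /hdelta h; rewrite /p extend0E.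
have ps i : smooth r.+1 (fun s => nrm s < delta) (fun s => p s ord0 i).
  apply: (@smooth_comp _ r.+1 d n _ V (fun x => extend0 V psi x ord0 i) pad) => //.
  apply: smooth_local => // x Vx; have [e e0 he] := oV x Vx; exists e => //.
  exists (fun x => psi x ord0 i); split=> [y /he Vy|]; first by rewrite extend0E.
  exact: smooth_sub he (psis i).
have hD i : exists D : 'I_d -> 'rV[R]_d -> R,
    (forall s, nrm s < delta -> has_diff (fun s => p s ord0 i) s (fun k => D k s)) /\
    forall k, smooth r (fun s => nrm s < delta) (D k).
  by have [_] := ps i.
have [D {}hD] := choice _ hD.
have z0 : nrm (0 : 'rV[R]_d) < delta by rewrite nrm0.
have p0 : p 0 = a by rewrite pE // pad0 -phia; have [] := hUV a Ua.
exists p, D, delta; split=> //.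
- move=> i; apply: (@dterm_fun _ _ hS n (fun x => extend0 V psi x ord0 i) (fun e => pad (\row_i e i))).
    exact: dfun_extend0.
  by move=> j; apply: dterm_row; apply: dterm_coords; definable hS.
- move=> s hs; have [_ h] := hchart (pad s).
  have [|x [Xx [Ux hx]]] := h.
    split; first exact: hdelta.
    by move=> k hk; rewrite mxE coords_ge.
  by rewrite pE // -hx; have [_ ->] := hUV x Ux.
- by move=> i; have [] := hD i.
- by move=> i; have [] := hD i.
- move=> rho rho0.
  have m0 : 0 < Num.min rho delta by rewrite lt_min rho0.
  have [e e0 he] := oU a Ua.
  have [e' e'0 he'] := continuous_row_at (fun i => smooth_continuous (phis i) Ua) m0.
  exists (Num.min e e'); first by rewrite lt_min e0.
  move=> x Xx; rewrite lt_min => /andP [/he Ux /he']; rewrite phia subr0 lt_min => /andP [hr hd].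
  have [h _] := hchart (phi x); have [|_ {}h] := h; first by exists x.
  pose s : 'rV[R]_d := \row_i coords (phi x) i.
  have padE : pad s = phi x.
    apply/rowP => i; rewrite mxE coords_row; case: ltnP => hi; first by rewrite coords_ord.
    by rewrite h.
  have hs : nrm s <= nrm (phi x).
    apply: nrm_le => [|i]; first exact: nrm_ge0.
    rewrite mxE /coords; case: insubP => [j _ _|_]; first exact: le_nrm.
    by rewrite normr0 nrm_ge0.
  exists s; first exact: le_lt_trans hs hr.
  rewrite pE; last exact: le_lt_trans hs hd.
  by rewrite padE; have [] := hUV x Ux.
(* Composing with the chart gives back the parameter: coordinate [j] of [phi (p s)] is [s_l]. By the
   chain rule [v_l] is a linear function of the image of [v] under the differential, and this image
   is 0. *)
move=> v hv; apply/rowP => l; rewrite mxE.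
pose j := widen_ord hdn l.
have [E hE] : exists E : 'I_n -> R, has_diff (fun x => phi x ord0 j) a E.
  have [_ [E [h _]]] := phis j; by exists (fun k => E k a); apply: h.
have h1 : has_diff (fun s => phi (p s) ord0 j) 0 (fun k => \sum_i E i * D i k 0).
  apply: (has_diff_comp (f := fun x => phi x ord0 j) (M := fun i k => D i k 0)); first by rewrite p0.
  by move=> i; have [h _] := hD i; apply: h.
have h2 : has_diff (fun s => phi (p s) ord0 j) 0 (fun k => (k == l)%:R).
  apply: (@has_diff_local _ _ (fun s => s ord0 l) _ _ _ delta) => //; last exact: has_diff_coord.
  move=> s; rewrite subr0 => hs; rewrite pE //; have [_ ->] := hVU _ (hdelta s hs).
  by rewrite mxE (coords_ord s l).
have hu := has_diff_unique h1 h2.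
have -> : v ord0 l = \sum_k v ord0 k * (k == l)%:R.
  by rewrite (bigD1 l) //= eqxx mulr1 big1 ?addr0 // => k /negbTE ->; rewrite mulr0.
rewrite (eq_bigr (fun k => \sum_i E i * (v ord0 k * D i k 0))); last first.
  by move=> k _; rewrite -hu mulr_sumr; apply: eq_bigr => i _; ring.
rewrite exchange_big big1 //= => i _; rewrite -mulr_sumr.
have hvi := congr1 (fun w : 'rV[R]_n => w ord0 i) hv; rewrite !mxE in hvi.
suff -> : \sum_k v ord0 k * D i k 0 = 0 by rewrite mulr0.
by rewrite -[RHS]hvi; apply: eq_bigr => k _; rewrite mxE.
Qed.

(* First-order form of: [coord_proj sigma] restricts to a local diffeomorphism
   of the submanifold [X] at [a]. *)
Definition bilipschitz_at n d (sigma : 'I_d -> 'I_n) (X : 'rV[R]_n -> Prop) a :=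
  X a /\ exists C delta, 0 < C /\ 0 < delta /\ forall y z, X y -> X z ->
    nrm (y - a) < delta -> nrm (z - a) < delta ->
    nrm (y - z) <= C * nrm (coord_proj sigma y - coord_proj sigma z).

Lemma structure_bilipschitz_at n d (sigma : 'I_d -> 'I_n) (X : 'rV[R]_n -> Prop) :
  S X -> S (bilipschitz_at sigma X).
Proof.
move=> hX; apply: (structure_dpred hS); rewrite /bilipschitz_at.
by repeat first [apply: (dpred_structure hS hX) | definable_row_step hS].
Qed.

Lemma bilipschitz_at_open n d (sigma : 'I_d -> 'I_n) (X : 'rV[R]_n -> Prop) a :
  bilipschitz_at sigma X a -> exists2 e, 0 < e &
    forall x, X x -> nrm (x - a) < e -> bilipschitz_at sigma X x.
Proof.
move=> [Xa [C [delta [C0 [delta0 h]]]]]; exists (delta / 2); first by lra.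
move=> x Xx hx; split=> //; exists C, (delta / 2); split=> //; split; first by lra.
move=> y z Xy Xz hy hz; apply: h => //.
  by have := nrm_triangle y x a; lra.
by have := nrm_triangle z x a; lra.
Qed.

Lemma nrm_mulmx n m (B : 'M[R]_(n, m)) :
  exists2 K, 0 < K & forall v : 'rV[R]_n, nrm (v *m B) <= K * nrm v.
Proof.
exists (1 + \sum_i \sum_j `|B i j|).
  by rewrite ltr_wpDr // sumr_ge0 // => i _; rewrite sumr_ge0.
have hB0 : 0 <= \sum_i \sum_j `|B i j| by rewrite sumr_ge0 // => i _; rewrite sumr_ge0.
move=> v; apply: nrm_le => [|j]; first by rewrite mulr_ge0 ?nrm_ge0 // addr_ge0.
rewrite mxE; apply: le_trans (ler_norm_sum _ _ _) _.
apply: (@le_trans _ _ (\sum_i \sum_j nrm v * `|B i j|)).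
  apply: ler_sum => i _; rewrite (bigD1 j) //= normrM.
  rewrite ler_wpDr ?ler_wpM2r ?le_nrm // sumr_ge0 // => k _.
  by rewrite mulr_ge0 ?nrm_ge0.
under eq_bigr => i _ do rewrite -mulr_sumr.
by rewrite -mulr_sumr mulrC ler_wpM2r ?nrm_ge0 // lerDr.
Qed.

Section Parametrized.
Variables (r n d : nat) (X : 'rV[R]_n -> Prop) (a : 'rV[R]_n).
Variables (p : 'rV[R]_d -> 'rV[R]_n) (D : 'I_n -> 'I_d -> 'rV[R]_d -> R) (delta : R).
Hypothesis hp : parametrization r X a p D delta.
Variable sigma : 'I_d -> 'I_n.

Let A : 'M[R]_d := \matrix_(k, l) D (sigma l) k 0.

(** The projected parametrization, normalized so that for invertible [A] its differential at 0 is
    the identity, as [local_inverse] requires. *)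
Let q s := (coord_proj sigma (p s) - coord_proj sigma a) *m invmx A.
Let Dq j k s := \sum_l D (sigma l) k s * invmx A l j.

Lemma normalized_dfun j : dfun S (fun s => q s ord0 j).
Proof.
apply: (@dterm_ext _ _ (fun e => \sum_l (p (\row_i e i) ord0 (sigma l) - a ord0 (sigma l)) * invmx A l j)).
  by move=> e; rewrite mxE; apply: eq_bigr => l _; rewrite !mxE.
by repeat first [apply: (dterm_fun hS (param_dfun hp _)) => ? | definable_row_step hS].
Qed.

Lemma normalized0 : q 0 = 0.
Proof. by rewrite /q (param0 hp) subrr mul0mx. Qed.

Lemma normalized_diff j s : nrm s < delta -> has_diff (fun s => q s ord0 j) s (fun k => Dq j k s).
Proof.
move=> hs.
have h (I : seq 'I_d) : has_diff (fun s => \sum_(l <- I) (p s ord0 (sigma l) - a ord0 (sigma l)) * invmx A l j) s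
    (fun k => \sum_(l <- I) D (sigma l) k s * invmx A l j).
  elim: I => [|l I IH].
    by apply: has_diff_ext (has_diff_const 0 s) => z; rewrite big_nil.
  have h1 := has_diff_add (param_diff hp (sigma l) hs) (has_diff_const (- a ord0 (sigma l)) s).
  apply: has_diff_ext (has_diff_add (has_diff_mul h1 (has_diff_const (invmx A l j) s)) IH) => z.
    by rewrite big_cons.
  by rewrite big_cons addr0 mulr0 addr0.
apply: has_diff_ext (h _) => // z.
by rewrite mxE; apply: eq_bigr => l _; rewrite !mxE.
Qed.

Lemma normalized_smooth j k : smooth r (fun s => nrm s < delta) (Dq j k).
Proof.
by apply: smooth_sum => l; apply: smooth_mul (param_smooth hp _ _) (smooth_const _ _ _).
Qed.

Lemma normalized_diff0 j k : A \in unitmx -> Dq j k 0 = (k == j)%:R.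
Proof.
move=> hA; have := congr1 (fun M : 'M[R]_d => M k j) (mulmxV hA).
rewrite !mxE => <-; apply: eq_bigr => l _; by rewrite mxE.
Qed.

(** Three estimates are chained: [p] is Lipschitz with constant [C], [q] shrinks distances at most
    by half, and [q] depends linearly on the projection, with bound [K]. By [param_onto] they reach
    all points of [X] near [a]. *)
Lemma unit_bilipschitz_at : A \in unitmx -> bilipschitz_at sigma X a.
Proof.
move=> hA; have d0 := param_gt0 hp.
have z0 : nrm (0 : 'rV[R]_d) < delta by rewrite nrm0.
split; first by rewrite -(param0 hp); apply: (param_in hp).
have [rho1 rho10 h1] := near_identity hS hdc d0 normalized_dfun normalized_diff
  (fun i k => smooth_continuous (normalized_smooth i k) z0) (fun i k => normalized_diff0 i k hA).
have h2 i : exists c rho, (0 < c /\ 0 < rho) /\ forall s t, nrm s <= rho -> nrm t <= rho ->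
    `|p s ord0 i - p t ord0 i| <= c * nrm (s - t).
  have [|||rho rho0 h] := @locally_lipschitz _ _ hS hdc d (fun s => p s ord0 i) (D i) delta
    (1 + \sum_k `|D i k 0|) d0 (param_dfun hp i).
  - exact: (param_diff hp).
  - by move=> k; apply: smooth_continuous (param_smooth hp i k) _.
  - by rewrite ltrDr ltr01.
  exists (1 + \sum_k `|D i k 0|), rho; split; last by move=> s t; apply: h.
  by split=> //; rewrite ltr_wpDr // sumr_ge0.
have [c {}h2] := choice _ h2.
have [||rho2 rho20 {}h2] := @common_radius R 'I_n (fun i rho => 0 < c i /\ forall s t, nrm s <= rho -> nrm t <= rho ->
    `|p s ord0 i - p t ord0 i| <= c i * nrm (s - t)).
- by move=> i; have [rho [[c0 rho0] h]] := h2 i; exists rho.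
- by move=> i x y [c0 h] _ hyx; split=> // s t hs ht; apply: h; lra.
pose C := 1 + \sum_i c i.
have hC i : c i <= C.
  rewrite /C (bigD1 i) //= addrCA lerDl addr_ge0 // sumr_ge0 // => k _.
  by have [/ltW] := h2 k.
have C0 : 0 < C by rewrite ltr_wpDr // sumr_ge0 // => k _; have [/ltW] := h2 k.
have [K K0 hK] := nrm_mulmx (invmx A).
have m0 : 0 < Num.min rho1 rho2 by rewrite lt_min rho10.
have [eta eta0 heta] := param_onto hp m0.
exists (C * (2 * K)), eta; split; first by rewrite !mulr_gt0.
split=> // y z Xy Xz hy hz.
have [s] := heta y Xy hy; rewrite lt_min => /andP [s1 s2] Es.
have [t] := heta z Xz hz; rewrite lt_min => /andP [t1 t2] Et.
have hyz : nrm (y - z) <= C * nrm (s - t).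
  apply: nrm_le => [|i]; first by rewrite mulr_ge0 ?nrm_ge0 // ltW.
  have [_ h] := h2 i; have := h s t (ltW s2) (ltW t2); rewrite Es Et !mxE => {}h.
  by apply: le_trans h _; rewrite ler_wpM2r ?nrm_ge0.
have hst : nrm (s - t) <= 2 * nrm (q s - q t).
  have := h1 rho1 (lexx _) s t (ltW s1) (ltW t1).
  have := nrmD (- (q s - q t - (s - t))) (q s - q t).
  by rewrite nrmN opprB subrK; lra.
have hq : nrm (q s - q t) <= K * nrm (coord_proj sigma y - coord_proj sigma z).
  by apply: le_trans (hK _); rewrite /q -mulmxBl Es Et opprB addrA subrK.
apply: le_trans hyz _; rewrite -mulrA ler_wpM2l ?(ltW C0) //.
by rewrite -mulrA; lra.
Qed.

(** If [v *m A = 0], moving the parameter by [t *: v] moves the projection by [o(t)] only, hence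
    also the point, by the Lipschitz bound. So the differential of [p] kills [v], and [v = 0]. *)
Lemma bilipschitz_at_unit : bilipschitz_at sigma X a -> A \in unitmx.
Proof.
move=> [Xa [C [delta1 [C0 [delta10 hL]]]]].
have z0 : nrm (0 : 'rV[R]_d) < delta by rewrite nrm0 (param_gt0 hp).
rewrite -row_free_unit -kermx_eq0; apply/eqP/row_matrixP => i0.
rewrite row0; set v := row i0 (kermx A).
have vA : v *m A = 0 by rewrite /v -row_mul mulmx_ker row0.
clearbody v.
apply: (param_inj hp); set w := v *m _.
apply/rowP => i; rewrite [RHS]mxE; apply/eqP; rewrite -normr_le0 leNgt; apply/negP => hw.
have wE j : w ord0 j = \sum_k D j k 0 * v ord0 k.
  by rewrite mxE; apply: eq_bigr => k _; rewrite mxE mulrC.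
have wsigma l : w ord0 (sigma l) = 0.
  have := congr1 (fun M : 'rV[R]_d => M ord0 l) vA; rewrite wE !mxE => E.
  by rewrite -[RHS]E; apply: eq_bigr => k _; rewrite mxE mulrC.
pose l1 := \sum_k `|v ord0 k|.
have l10 : 0 <= l1 by apply: sumr_ge0.
(* Makes the final bound [(1 + C) * (e * l1)] at most half of [|w_i|]; [l1 + 1] excludes a zero
   denominator. *)
pose e := `|w ord0 i| / (2 * ((1 + C) * (l1 + 1))).
have den0 : 0 < 2 * ((1 + C) * (l1 + 1)) by rewrite !mulr_gt0 //; lra.
have e0 : 0 < e by rewrite divr_gt0.
have hF : frechet (fun s j => p s ord0 j) 0 (fun jk => D jk.1 jk.2 0).
  by apply: has_diff_frechet => j; apply: (param_diff hp).
have [d1 [d10 hd1]] := hF e e0.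
have hpc : forall j, continuous_at (fun s => p s ord0 j) 0.
  by move=> j; apply: has_diff_continuous (param_diff hp j z0).
have [d2 d20 hd2] := continuous_row_at hpc delta10.
have hv0 : 0 <= nrm v by apply: nrm_ge0.
have m0 : 0 < Num.min (Num.min d1 d2) delta by rewrite !lt_min d10 d20 (param_gt0 hp).
pose t := Num.min (Num.min d1 d2) delta / (nrm v + 1).
have t0 : 0 < t by rewrite divr_gt0 //; lra.
have ht : nrm (t *: v) < Num.min (Num.min d1 d2) delta.
  apply: le_lt_trans (nrmZ _ _) _; rewrite gtr0_norm //.
  have : t * (nrm v + 1) = Num.min (Num.min d1 d2) delta by rewrite divfK // gt_eqF //; lra.
  by rewrite mulrDr mulr1 => <-; rewrite ltrDl.
move: ht; rewrite !lt_min => /andP [/andP [ht1 ht2] ht3].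
have hest j : `|p (t *: v) ord0 j - p 0 ord0 j - t * w ord0 j| <= e * (t * l1).
  have := hd1 (t *: v) (fun k => le_lt_trans (le_nrm _ k) ht1) j; rewrite add0r.
  have -> : \sum_k D j k 0 * (t *: v) ord0 k = t * w ord0 j.
    by rewrite wE mulr_sumr; apply: eq_bigr => k _; rewrite mxE; ring.
  have -> : \sum_k `|(t *: v) ord0 k| = t * l1.
    by rewrite mulr_sumr; apply: eq_bigr => k _; rewrite mxE normrM gtr0_norm.
  by [].
have elt0 : 0 <= e * (t * l1) by rewrite (mulr_ge0 (ltW e0) (mulr_ge0 (ltW t0) l10)).
have := hL (p (t *: v)) (p 0); rewrite (param0 hp) subrr nrm0 => /(_ (param_in hp ht3) Xa).
have := hd2 (t *: v); rewrite subr0 (param0 hp) => /(_ ht2) => h1 /(_ h1 delta10) h2.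
have h3 : nrm (coord_proj sigma (p (t *: v)) - coord_proj sigma a) <= e * (t * l1).
  apply: nrm_le => // l; have := hest (sigma l).
  by rewrite wsigma mulr0 subr0 (param0 hp) !mxE.
have h4 : t * `|w ord0 i| <= (1 + C) * (e * (t * l1)).
  have h5 := le_trans (le_nrm _ i) h2; rewrite !mxE in h5.
  have h6 := hest i; rewrite (param0 hp) distrC in h6.
  have h7 : C * nrm (coord_proj sigma (p (t *: v)) - coord_proj sigma a) <= C * (e * (t * l1)).
    by rewrite ler_wpM2l // ltW.
  have := ler_normD (t * w ord0 i - (p (t *: v) ord0 i - a ord0 i)) (p (t *: v) ord0 i - a ord0 i).
  by rewrite subrK normrM (gtr0_norm t0); lra.
have h5 : `|w ord0 i| <= (1 + C) * (e * l1).
  by rewrite -(ler_pM2l t0); apply: le_trans h4 _; rewrite le_eqVlt; apply/orP; left; apply/eqP; ring.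
have E : e * (2 * ((1 + C) * (l1 + 1))) = `|w ord0 i| by rewrite divfK // gt_eqF.
have : 0 <= e * (1 + C) by rewrite mulr_ge0 //; lra.
have : e * (2 * ((1 + C) * (l1 + 1))) = 2 * ((1 + C) * (e * l1)) + 2 * (e * (1 + C)) by ring.
lra.
Qed.

(** The section is [p] after the local inverse of [q] after the affine map [w]. The bound [eta]
    later confines it to a ball on which the projection is injective. *)
Lemma local_section : bilipschitz_at sigma X a -> forall eta, 0 < eta ->
  exists2 e, 0 < e & exists t : 'rV[R]_d -> 'rV[R]_n,
    (forall u, nrm (u - coord_proj sigma a) < e ->
       [/\ X (t u), coord_proj sigma (t u) = u & nrm (t u - a) < eta]) /\
    forall i, smooth r.+1 (fun u => nrm (u - coord_proj sigma a) < e) (fun u => t u ord0 i).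
Proof.
move=> /bilipschitz_at_unit hA eta eta0.
have z0 : nrm (0 : 'rV[R]_d) < delta by rewrite nrm0 (param_gt0 hp).
have [e1 e10 [g [hg hgs]]] := local_inverse hS hdc (param_gt0 hp) normalized_dfun normalized0
  normalized_diff normalized_smooth (fun i k => normalized_diff0 i k hA).
have hpc : forall j, continuous_at (fun s => p s ord0 j) 0.
  by move=> j; apply: has_diff_continuous (param_diff hp j z0).
have [d1 d10 hd1] := continuous_row_at hpc eta0.
have [K K0 hK] := nrm_mulmx (invmx A).
(* The halves compensate for [nrm (g u) <= 2 * nrm u], and the radius [m / K] for the factor
   [invmx A] in [w]. *)
pose m := Num.min e1 (Num.min (d1 / 2) (delta / 2)).
have dd := param_gt0 hp.
have m0 : 0 < m by rewrite !lt_min e10; lra.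
pose w u := (u - coord_proj sigma a) *m invmx A.
have hw u : nrm (u - coord_proj sigma a) < m / K ->
    [/\ nrm (w u) < e1, nrm (g (w u)) < d1 & nrm (g (w u)) < delta].
  rewrite ltr_pdivlMr // mulrC => hu.
  have := le_lt_trans (hK _) hu; rewrite -/(w u) !lt_min => /and3P [h1 h2 h3].
  by have [h4 _] := hg _ h1; split=> //; lra.
exists (m / K); first by rewrite divr_gt0.
exists (fun u => p (g (w u))); split.
  move=> u /hw [h1 h2 h3]; split; first exact: (param_in hp).
    have [_ h4] := hg _ h1; have := congr1 (mulmx^~ A) h4.
    by rewrite /q /w !mulmxKV // => /addIr.
  by have := hd1 (g (w u)); rewrite subr0 (param0 hp); apply.
move=> i; apply: (@smooth_comp _ r.+1 d d _ (fun s => nrm s < delta) (fun s => p s ord0 i) (fun u => g (w u))).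
- by move=> u /hw [].
- split; first by move=> s hs; apply: has_diff_continuous (param_diff hp i hs).
  exists (D i); split; first exact: (param_diff hp).
  exact: (param_smooth hp).
move=> j0; apply: (@smooth_comp _ r.+1 d d _ (fun s => nrm s < e1) (fun s => g s ord0 j0) w) => //.
  by move=> u /hw [].
move=> j; pose c := coord_proj sigma a.
apply: (@smooth_ext _ _ _ _ (fun u => \sum_l (u ord0 l + - c ord0 l) * invmx A l j)).
  by move=> u; rewrite mxE; apply: eq_bigr => l _; rewrite !mxE.
apply: smooth_sum => l; apply: smooth_mul; last exact: smooth_const.
by apply: smooth_add; [apply: smooth_coord | apply: smooth_const].
Qed.

End Parametrized.

End LocalSections.

(** * Invertible minors with increasing row indices *)

Section IncreasingMinor.
Variable F : fieldType.

Lemma increasing_enumeration n d (I : {set 'I_n}) : #|I| = d ->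
  exists sigma : 'I_d -> 'I_n, (forall i j : 'I_d, (i < j)%N -> (sigma i < sigma j)%N) /\
    forall x, x \in I -> exists i, sigma i = x.
Proof.
move=> <-; exists (fun i => enum_val i); split; last first.
  by move=> x xI; exists (enum_rank_in xI x); rewrite enum_rankK_in.
move=> i j ij; have x0 : 'I_n := enum_val i.
rewrite !(enum_val_nth x0).
have hs : sorted (fun x y : 'I_n => (x < y)%N) (enum I).
  rewrite /enum_mem; apply: sorted_filter; first by move=> ? ? ?; apply: ltn_trans.
  have := iota_ltn_sorted 0 n; rewrite -val_enum_ord sorted_map.
  by rewrite enumT.
by apply: (sorted_ltn_nth _ _ hs) => //; [move=> ? ? ?; apply: ltn_trans | |];
  rewrite inE -cardE.
Qed.

(** [fullrankfun] selects [d] independent rows in some order; listing the same rows increasingly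
    keeps the row space. *)
Lemma increasing_full_minor n d (N : 'M[F]_(n, d)) : row_full N ->
  exists sigma : 'I_d -> 'I_n, (forall i j : 'I_d, (i < j)%N -> (sigma i < sigma j)%N) /\
    rowsub sigma N \in unitmx.
Proof.
move=> hN; pose f := fullrankfun hN.
have [|sigma [hs hI]] := @increasing_enumeration n d [set f i | i in 'I_d].
  by rewrite card_imset ?card_ord //; apply: fullrankfun_inj.
exists sigma; split=> //; rewrite -row_full_unit -sub1mx.
have hf : (1%:M <= rowsub f N)%MS by rewrite sub1mx; apply: fullrowsub_full.
apply: submx_trans hf _.
apply/row_subP => i; have [j hj] := hI (f i) (imset_f _ isT).
rewrite row_rowsub -hj -row_rowsub; exact: row_sub.
Qed.

End IncreasingMinor.

(** * The cover by bi-Lipschitz loci *)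

Section Cover.
Variables (R : realFieldType) (S : structure R).
Hypotheses (hS : is_structure S) (hdc : definably_complete S) (hlo : locally_o_minimal S).

Lemma submanifold_bilipschitz_cover r n d (X : 'rV[R]_n -> Prop) a :
  Dr_submanifold_dim S r.+1 d X -> X a ->
  exists sigma : 'I_d -> 'I_n, (forall i j : 'I_d, (i < j)%N -> (sigma i < sigma j)%N) /\
    bilipschitz_at sigma X a.
Proof.
move=> hX Xa; have [p [D [delta hp]]] := submanifold_param hS hX Xa.
pose N : 'M[R]_(n, d) := \matrix_(i, k) D i k 0.
have [|sigma [hs hu]] := @increasing_full_minor _ n d N.
  rewrite /row_full -mxrank_tr -/(row_free N^T) -kermx_eq0; apply/eqP/row_matrixP => i.
  rewrite row0; apply: (param_inj hp).
  have -> : \matrix_(k, i) D i k 0 = N^T by apply/matrixP => k l; rewrite !mxE.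
  by rewrite -row_mul mulmx_ker row0.
exists sigma; split=> //; apply: (unit_bilipschitz_at hS hdc hp).
rewrite -unitmx_tr; move: hu; congr (_ \in unitmx).
by apply/matrixP => k l; rewrite !mxE.
Qed.

Definition cube n (x : 'rV[R]_n) e (s : bool) (i : 'I_n) := if s then x ord0 i + e else x ord0 i - e.

Lemma inbox_cube n (x y : 'rV[R]_n) e : 0 < e ->
  inbox (cube x e false) (cube x e true) y <-> nrm (y - x) < e.
Proof.
move=> e0; split=> h.
  apply: nrm_lt => // i; have := h i; rewrite /cube !mxE ltr_norml; lra.
move=> i; have := le_lt_trans (le_nrm _ i) h; rewrite /cube !mxE ltr_norml; lra.
Qed.

Lemma box_ok_cube n (x : 'rV[R]_n) e : 0 < e -> box_ok (cube x e false) (cube x e true).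
Proof. by move=> e0 i; rewrite /cube; lra. Qed.

Section QuasiSpecial.
Variables (r n d : nat) (X : 'rV[R]_n -> Prop) (sigma : 'I_d -> 'I_n).
Hypothesis hX : Dr_submanifold_dim S r.+1 d X.

Let Y := bilipschitz_at sigma X.
Let pi := @coord_proj R n d sigma.

(** [Y] is open in [X], so a smaller [eta] keeps the section given by [local_section] inside [Y]. *)
Lemma bilipschitz_section a : Y a -> forall eta, 0 < eta ->
  exists2 e, 0 < e & exists t : 'rV[R]_d -> 'rV[R]_n,
    (forall u, nrm (u - pi a) < e -> [/\ Y (t u), pi (t u) = u & nrm (t u - a) < eta]) /\
    forall i, smooth r.+1 (fun u => nrm (u - pi a) < e) (fun u => t u ord0 i).
Proof.
move=> Ya eta eta0; have [Xa _] := Ya.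
have [p [D [delta hp]]] := submanifold_param hS hX Xa.
have [e0 e00 he0] := bilipschitz_at_open Ya.
have m0 : 0 < Num.min eta e0 by rewrite lt_min eta0.
have [e e_gt0 [t [ht hts]]] := local_section hS hdc hp Ya m0.
exists e => //; exists t; split=> // u /ht [h1 h2]; rewrite lt_min => /andP [h3 h4].
by split=> //; apply: he0.
Qed.

(* [fiber_radius x y e]: over the cube of radius [e] around [x], the part of
   [Y] near [y] is the graph of a function. *)
Definition fiber_radius (x : 'rV[R]_d) (y : 'rV[R]_n) e := exists delta, 0 < delta /\ e <= delta /\
  (forall z z', Y z -> Y z' -> nrm (z - y) < delta -> nrm (z' - y) < delta -> pi z = pi z' -> z = z') /\
  forall u, nrm (u - x) < e -> exists z, Y z /\ nrm (z - y) < delta /\ pi z = u.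

Lemma bilipschitz_injective a : Y a -> exists2 delta, 0 < delta &
  forall z z', Y z -> Y z' -> nrm (z - a) < delta -> nrm (z' - a) < delta -> pi z = pi z' -> z = z'.
Proof.
move=> [_ [C [delta [C0 [delta0 h]]]]]; exists delta => // z z' [Xz _] [Xz' _] hz hz' E.
apply/eqP; rewrite -subr_eq0; apply/eqP/nrm_eq0; apply: le_trans (h z z' Xz Xz' hz hz') _.
by rewrite -/(pi z) -/(pi z') E subrr nrm0 mulr0.
Qed.

Lemma structure_fiber (x : 'rV[R]_d) : S (fun y => Y y /\ pi y = x).
Proof.
have [SX _] := hX; apply: (structure_dpred hS); apply: (dpred_and hS).
  by apply: (dpred_structure hS (structure_bilipschitz_at hS sigma SX)); definable hS.
by apply: (dpred_eq_row hS) => i; repeat definable_row_step hS.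
Qed.

Lemma uniform_fiber_radius (x : 'rV[R]_d) :
  exists2 e, 0 < e & forall y, Y y -> pi y = x -> fiber_radius x y e.
Proof.
have [SX _] := hX; have SY := structure_bilipschitz_at hS sigma SX.
have [|||||e e0 he] := @uniform_radius _ _ hS hdc hlo n (fiber_radius x) (fun y => Y y /\ pi y = x).
- rewrite /fiber_radius.
  by repeat first [apply: (dpred_structure hS SY) | apply: (dpred_eq_row hS) => ? | definable_row_step hS].
- exact: structure_fiber.
- move=> y [Yy E]; have [delta delta0 hinj] := bilipschitz_injective Yy.
  have [e e0 [t [ht _]]] := bilipschitz_section Yy delta0.
  exists (Num.min e delta); first by rewrite lt_min e0.
  move=> e'; rewrite le_min => e'0 /andP [h1 h2].
  exists delta; do 3!split=> //; move=> u hu; exists (t u).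
  by have [|? ? ?] := ht u; first by rewrite E; apply: lt_le_trans h1.
- move=> y e e' [delta [delta0 [hed [h1 h2]]]] e'0 hee'; exists delta; split=> //.
  split; first exact: le_trans hed.
  by split=> // u hu; apply: h2; apply: lt_le_trans hee'.
(* Points of one fiber have equal projections, so local injectivity isolates [y] in its fiber. *)
- move=> y [Yy E]; have [delta delta0 hinj] := bilipschitz_injective Yy.
  exists delta => // y' [Yy' E'] hne; apply: NNPP => hno; apply: hne.
  apply: hinj => //; [|by rewrite subrr nrm0|by rewrite E E'].
  apply: nrm_lt => // i; rewrite !mxE ltNge; apply/negP => hi; apply: hno; by exists i.
by exists e => // y Yy E; apply: he.
Qed.

(** [tau] is picked pointwise. Injectivity of the projection on the [delta]-ball around [y] makes it
    unique, which yields both its definability and its smoothness, the latter because it agrees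
    locally with the sections of [bilipschitz_section]. *)
Lemma fiber_section x y e : 0 < e -> Y y -> pi y = x -> fiber_radius x y e ->
  exists loV hiV, box_ok loV hiV /\ inbox loV hiV y /\
    exists tau : 'rV[R]_d -> 'rV[R]_n,
      Dr_map S r.+1 (inbox (cube x e false) (cube x e true)) tau /\
      (forall u, inbox (cube x e false) (cube x e true) u <-> exists v, inbox loV hiV v /\ pi v = u) /\
      (forall z, (exists u, inbox (cube x e false) (cube x e true) u /\ tau u = z) <->
                 (Y z /\ inbox loV hiV z)) /\
      (forall u, inbox (cube x e false) (cube x e true) u -> pi (tau u) = u).
Proof.
move=> e0 Yy Ey [delta [delta0 [hed [hinj hex]]]].
have [SX _] := hX; have SY := structure_bilipschitz_at hS sigma SX.
(* Half-width [e] in the projected directions makes the box project exactly onto the cube around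
   [x]; as [e <= delta], the box stays in the [delta]-ball. *)
pose rad (i : 'I_n) := if [exists j, sigma j == i] then e else delta.
have rad0 i : 0 < rad i by rewrite /rad; case: ifP.
have radle i : rad i <= delta by rewrite /rad; case: ifP.
have radsigma j : rad (sigma j) = e by rewrite /rad; case: existsP => // -[]; exists j.
pose lo i := y ord0 i - rad i; pose hi i := y ord0 i + rad i.
have inV z : inbox lo hi z <-> nrm (pi z - x) < e /\ nrm (z - y) < delta.
  split=> [h|[h1 h2] i].
    split; apply: nrm_lt => // i; last first.
      by have := h i; have := radle i; rewrite /lo /hi !mxE ltr_norml; lra.
    by have := h (sigma i); rewrite /lo /hi radsigma -Ey !mxE ltr_norml; lra.
  rewrite /lo /hi /rad; case: ifP => [/existsP [j /eqP <-]|_].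
    by have := le_lt_trans (le_nrm _ j) h1; rewrite -Ey !mxE ltr_norml; lra.
  by have := le_lt_trans (le_nrm _ i) h2; rewrite !mxE ltr_norml; lra.
have hex' u : exists z, nrm (u - x) < e -> Y z /\ nrm (z - y) < delta /\ pi z = u.
  case: (ltP (nrm (u - x)) e) => [/hex [z hz]|_]; last by exists y.
  by exists z.
have [tau htau] := choice _ hex'.
exists lo, hi; split; first by move=> i; rewrite /lo /hi; have := rad0 i; lra.
split; first by apply/inV; rewrite Ey !subrr !nrm0.
exists tau; split; [split | split; [|split]].
- apply: (structure_dpred hS).
  have hl (i : 'I_d) : dterm S (fun f => lsubmx (\row_(i < d + n) f i) ord0 i).
    by apply: dterm_ext (dterm_var hS (lshift n i)) => f; rewrite !mxE.
  have hr (i : 'I_n) : dterm S (fun f => rsubmx (\row_(i < d + n) f i) ord0 i).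
    by apply: dterm_ext (dterm_var hS (rshift d i)) => f; rewrite !mxE.
  apply: (@dpred_iff _ _ (fun f => let u := lsubmx (\row_(i < d + n) f i) in let z := rsubmx (\row_(i < d + n) f i) in
     nrm (u - x) < e /\ Y z /\ nrm (z - y) < delta /\ pi z = u)) => [f|].
    rewrite /=; set u := lsubmx _; set z := rsubmx _; rewrite inbox_cube //.
    split=> [[h1 [h2 [h3 h4]]]|[h1 h2]]; split=> //; last by rewrite -h2; apply: htau.
    by have [h5 [h6 h7]] := htau u h1; apply: hinj => //; rewrite h7.
  rewrite /=; repeat first [exact: hl | exact: hr | apply: (dpred_structure hS SY)
    | apply: (dpred_eq_row hS) => ? | definable_row_step hS].
- apply: smooth_Cr => i.
  apply: (@smooth_sub _ _ _ (fun u => nrm (u - x) < e)); first by move=> u /(inbox_cube _ _ e0).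
  apply: smooth_local; first exact: ball_open_ball.
  move=> u hu; have [Yz [hz Ez]] := htau u hu.
  (* This margin keeps the section through [tau u] in the [delta]-ball around [y], where it must
     coincide with [tau]. *)
  have eta0 : 0 < delta - nrm (tau u - y) by rewrite subr_gt0.
  have [e1 e10 [t [ht hts]]] := bilipschitz_section Yz eta0.
  exists (Num.min e1 (e - nrm (u - x))); first by rewrite lt_min e10 subr_gt0.
  exists (fun v => t v ord0 i); split.
    move=> v; rewrite lt_min => /andP [h1 h2]; congr (_ _ ord0 i).
    have [|Yt Et nt] := ht v; first by rewrite Ez.
    have [|Yv [nv Ev]] := htau v; first by have := nrm_triangle v u x; lra.
    apply: hinj => //; first by have := nrm_triangle (t v) (tau u) y; lra.
    by rewrite Et Ev.
  by apply: smooth_sub (hts i) => v; rewrite lt_min Ez => /andP [].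
- move=> u; rewrite inbox_cube //; split=> [hu|[v [/inV [h1 _] <-]] //].
  by have [Yz [hz Ez]] := htau u hu; exists (tau u); split=> //; apply/inV; rewrite Ez.
- move=> z; split=> [[u [/(inbox_cube _ _ e0) hu <-]]|[Yz /inV [h1 h2]]].
    by have [Yz [hz Ez]] := htau u hu; split=> //; apply/inV; rewrite Ez.
  exists (pi z); split; first exact/inbox_cube.
  by have [Yt [ht Et]] := htau _ h1; apply: hinj.
- by move=> u /(inbox_cube _ _ e0) hu; have [_ []] := htau u hu.
Qed.

Lemma bilipschitz_pi_quasi_special : pi_quasi_special S r.+1 sigma Y.
Proof.
split=> [u [y [Yy <-]]|x _].
  have [e e0 [t [ht _]]] := bilipschitz_section Yy ltr01.
  exists (cube (pi y) e false), (cube (pi y) e true); split; first exact: box_ok_cube.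
  split; first by apply/inbox_cube; rewrite // subrr nrm0.
  by move=> v /(inbox_cube _ _ e0) /ht [h1 h2 _]; exists (t v).
have [e e0 he] := uniform_fiber_radius x.
exists (cube x e false), (cube x e true); split; first exact: box_ok_cube.
split; first by apply/inbox_cube; rewrite // subrr nrm0.
move=> y Yy Ey; exact: fiber_section (he y Yy Ey).
Qed.

End QuasiSpecial.

End Cover.

Theorem theorem4p12 (R : realFieldType) (S : structure R)
  (hS : is_structure S) (hdc : definably_complete S)
  (hlo : locally_o_minimal S) (r n : nat) (X : 'rV[R]_n -> Prop) :
  (1 <= r)%N -> Dr_submanifold S r X ->
  exists (k : nat) (Y : 'I_k -> 'rV[R]_n -> Prop),
    (forall i, S n (Y i) /\ (forall y, Y i y -> X y) /\
               open_in X (Y i) /\ quasi_special S r (Y i)) /\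
    (forall x, X x -> exists i, Y i x).
Proof.
case: r => // r _ [d hX].
(* Encoded as finite functions, the increasing maps form a finite type's subset that can be
   enumerated to index the cover. *)
pose incr (f : {ffun 'I_d -> 'I_n}) :=
  [forall i : 'I_d, forall j : 'I_d, (i < j)%N ==> (f i < f j)%N].
pose fs := in_tuple (enum incr).
exists _, (fun i => bilipschitz_at (tnth fs i) X); split; last first.
  move=> a Xa; have [sigma [hs ha]] := submanifold_bilipschitz_cover hS hdc hX Xa.
  have /tnthP [i hi] : [ffun i => sigma i] \in fs.
    rewrite mem_enum; apply/forallP => i; apply/forallP => j; apply/implyP => ij.
    by rewrite !ffunE; apply: hs.
  exists i; rewrite -hi.
  suff -> : fun_of_fin [ffun i => sigma i] = sigma by [].
  by apply: functional_extensionality => j; rewrite ffunE.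
move=> i; move: (mem_tnth i fs); rewrite mem_enum; move: (tnth fs i) => f hf.
have [SX _] := hX.
split; first exact: structure_bilipschitz_at.
split; first by move=> y [].
split.
  move=> y hy; have [e e0 he] := bilipschitz_at_open hy.
  exists (cube y e false), (cube y e true); split; first exact: box_ok_cube.
  split; first by apply/inbox_cube; rewrite // subrr nrm0.
  by move=> z Xz /(inbox_cube _ _ e0); apply: he.
exists d, f; split; last exact: bilipschitz_pi_quasi_special.
move=> j k jk; have /forallP /(_ j) /forallP /(_ k) /implyP := hf; exact.
Qed.
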